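(* Let $\alpha\in(0,1)$. Let $K$ satisfy: $K\in L^1(\mathbb R)$ is bounded and continuous, $K\ge 0$, $K(0)>0$, and $K(x)=K(-x)$ for all $x\in\mathbb R$. Put $\kappa=\int_{\mathbb R}K(y)\,dy$ and let $u_T\in(0,\kappa)$. Let $u_0\in C^1(\mathbb R)$ satisfy $u_0'<0$ on $\mathbb R$, $u_0(0)=u_T$, $\lim_{x\to-\infty}u_0(x)=\kappa$ and $\lim_{x\to+\infty}u_0(x)=0$. Let $x^*\in C[0,+\infty)$ be the threshold location with initial datum $u_0$, and let $c^*\in\mathbb R$ be the unique solution $c$ of $u_T=\int_0^{+\infty}g_\alpha(r)\mathcal K(cr)\,dr$. Suppose that $\kappa\ne 2u_T$. Then for every $L>0$, $$\lim_{t\to+\infty}\ \sup_{0\le r\le L}\left|x^*(t)-x^*(t-r)-c^*r\right|=0.$$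
   Context: Notation: $\mathcal K(x)=\int_x^{+\infty}K(y)\,dy$; $E_{\alpha,\beta}(z)=\sum_{n=0}^\infty \frac{z^n}{\Gamma(\alpha n+\beta)}$; $f_\alpha(t)=E_{\alpha,1}(-t^\alpha)$ for $t\ge0$ and $g_\alpha(t)=t^{\alpha-1}E_{\alpha,\alpha}(-t^\alpha)$ for $t>0$. The threshold location $x^*$ is the unique function $x^*\in C[0,+\infty)$ with $x^*(0)=0$ such that for all $t\ge0$ $$f_\alpha(t)u_0(x^*(t))+\int_0^t g_\alpha(t-s)\,\mathcal K(x^*(t)-x^*(s))\,ds=u_T .$$ Equivalently, it is the unique point where the front solution $u(t,\cdot)$ of the time-fractional Amari equation $\partial_t^\alpha u=\int_{\mathbb R}K(x-y)H(u(t,y)-u_T)\,dy-u$ (Caputo derivative, Heaviside function $H$, initial datum $u_0$) crosses the level $u_T$. *)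

(* Defs.v *)
From HB Require Import structures.
From mathcomp Require Import all_boot all_order all_algebra.
From mathcomp Require Import all_classical all_reals all_analysis.

Set Implicit Arguments.
Unset Strict Implicit.
Unset Printing Implicit Defensive.

Import Order.TTheory GRing.Theory Num.Theory.
Import numFieldNormedType.Exports.

Local Open Scope classical_set_scope.
Local Open Scope ring_scope.

(* Euler's integral; only meaningful for 0 < a. *)
Definition Gamma {R : realType} (a : R) : R :=
  \int[@lebesgue_measure R]_(x in `]0, +oo[) (x `^ (a - 1) * expR (- x)).

Definition mittag_leffler {R : realType} (a b z : R) : R :=
  limn (series (fun n : nat => z ^+ n / Gamma (a * n%:R + b))).

Definition f_ {R : realType} (a t : R) : R := mittag_leffler a 1 (- (t `^ a)).

(* Only meaningful for 0 < t; [powR] makes the value at t = 0 a junk finite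
   one, which no integral below sees. *)
Definition g_ {R : realType} (a t : R) : R :=
  t `^ (a - 1) * mittag_leffler a a (- (t `^ a)).

Definition tail_integral {R : realType} (K : R -> R) (x : R) : R :=
  \int[@lebesgue_measure R]_(y in `[x, +oo[) K y.

(* [xs] is a total function, but only its values on [0, +oo[ are constrained. *)
Definition is_threshold_location {R : realType} (a : R) (K : R -> R) (uT : R)
    (u0 xs : R -> R) : Prop :=
  [/\ {within `[0, +oo[, continuous xs},
      xs 0 = 0 &
      forall t : R, 0 <= t ->
        f_ a t * u0 (xs t) +
        \int[@lebesgue_measure R]_(s in `[0, t])
          (g_ a (t - s) * tail_integral K (xs t - xs s)) = uT].

Definition is_wave_speed {R : realType} (a : R) (K : R -> R) (uT c : R) : Prop :=
  uT = \int[@lebesgue_measure R]_(r in `]0, +oo[)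
         (g_ a r * tail_integral K (c * r)).

(* Main.v *)
Require Import Defs.
From HB Require Import structures.
From mathcomp Require Import all_boot all_order all_algebra.
From mathcomp Require Import all_classical all_reals all_analysis.
From mathcomp Require Import measurable_realfun ring lra.

Set Implicit Arguments.
Unset Strict Implicit.
Unset Printing Implicit Defensive.

Import Order.TTheory GRing.Theory Num.Theory.
Import numFieldNormedType.Exports.

Local Open Scope classical_set_scope.
Local Open Scope ring_scope.

(** Write k for the tail integral of K. Since f_ a is the mass that the kernel
    g_ a leaves beyond a given time, the threshold equation says that a mean over
    the elapsed time r, with weight g_ a r, equals uT: the mean of k (x t - x (t - r))
    for r <= t and of u0 (x t) for r > t. The wave speed equation says the same of
    the straight line of slope cs. The study of fronts uses only that the weight
    is nonnegative, nonincreasing, of mass one, and has f_ a as tail mass; this is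
    [memory_kernel], and the mean is [avg].

    The kernel. The sign and the monotonicity of g_ a are not visible on its
    alternating series. They are read on a discrete model instead: the power
    series of (1-z) / ((1-z)^a + lam) in z is the inverse of one with positive
    log-convex coefficients, so by Kaluza's argument all its coefficients but the
    first are nonpositive ([Kaluza]). Its partial sums are then nonnegative and
    nonincreasing, and with lam = (t/n)^a the n-th of them, rescaled, converges to
    g_ a t: each term converges by Euler's limit formula for the Gamma function
    ([negbin_cvg]), and Bernoulli's inequality gives the domination that Tannery's
    theorem asks for ([discrete_ml_limit]). The same model gives the decay of f_ a.

    The front is equicontinuous. Reflecting space exchanges uT and kappa - uT, so
    that one may assume uT < kappa / 2 = k 0. Comparing the balances at a high
    point and at a later low point of the front shows that it never moves back
    ([front_nondecreasing]). If it advanced by a fixed amount in a tiny time, it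
    would have done so just before as well ([increment_le_increment]), and so on
    backwards: it would cover a distance D with k D <= uT / 2 in a short time,
    which the balance forbids since nearly all of the memory would then lie far
    behind ([large_increment_time]).

    The speed. Fix h > 0 and let M be the upper limit of the increments
    x (t + h) - x t. When an increment is close to M, subtracting the balances at
    t + h and at t shows that the earlier increments are close to M as well, over
    any given length of time: a strong maximum principle ([near_max_backward],
    [near_max_long]). Over that time x is close to a line of slope M / h plus an
    h-periodic function. Seen from a maximum of this function, the past of the
    front lies below the line, so that uT is at most the mean of k (M / h * r),
    hence M / h <= cs ([limsup_increment_le]). The reflected front bounds the lower
    limit, and equicontinuity makes the convergence uniform for r in [0, L]. *)

(** * Fundamental theorem of calculus on the open half-line *)

Lemma continuous_measurable0y {R : realType} (f : R -> R) :
  (forall x : R, 0 < x -> {for x, continuous f}) ->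
  measurable_fun `](0:R), +oo[ f.
Proof.
move=> cf; apply: open_continuous_measurable_fun => // x.
by rewrite inE/= in_itv/= andbT; exact: cf.
Qed.

(** The integrand may blow up at 0: exhaust the half-line by `[1/(n+1), +oo[ and use
    monotone convergence. *)
Lemma ge0_FTC0y {R : realType} (f F : R -> R) (l0 l : R) :
  (forall x : R, 0 < x -> {for x, continuous f}) ->
  (forall x : R, 0 < x -> 0 <= f x) ->
  (forall x : R, 0 < x -> is_derive x 1 F (f x)) ->
  F x @[x --> 0^'+] --> l0 -> F x @[x --> +oo] --> l ->
  (\int[@lebesgue_measure R]_(x in `]0%R, +oo[) (f x)%:E = (l - l0)%:E)%E.
Proof.
move=> cf f0 dF F0 Fl.
pose I n := `[(n.+1%:R^-1 : R), +oo[%classic.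
have I0 n : 0 < (n.+1%:R^-1 : R) by rewrite invr_gt0 ltr0n.
have UI : `]0, +oo[%classic = \bigcup_n I n.
  apply/seteqP; split => x /=.
    rewrite in_itv/= andbT => x0.
    have [n nx] : exists n : nat, n.+1%:R^-1 < x.
      have := @cvg_harmonic R => /cvgrPdist_lt/(_ _ x0)[n _ /(_ n (leqnn n))].
      by rewrite sub0r normrN ger0_norm ?(ltW (I0 _))// => nx; exists n.
    by exists n => //; rewrite /I/= in_itv/= andbT ltW.
  move=> [n _]. rewrite /I/= !in_itv/= !andbT; exact: lt_le_trans.
have mI n : measurable (I n) by exact: measurable_itv.
have cfy : measurable_fun `](0:R), +oo[ f.
  exact: continuous_measurable0y.
transitivity (limn (fun n => \int[@lebesgue_measure R]_(x in I n) (f x)%:E)%E).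
  rewrite UI; apply/esym/cvg_lim => //.
  apply: ge0_nondecreasing_set_cvg_integral => //.
  - move=> n m nm; apply/subsetPset => x; rewrite /I/= !in_itv/= !andbT.
    by apply: le_trans; rewrite lef_pV2 ?posrE ?ltr0n// ler_nat ltnS.
  - move=> n; apply/measurable_EFinP; apply: measurable_funS cfy => //.
    by move=> x; rewrite /I/= !in_itv/= !andbT; exact: lt_le_trans.
  - move=> n x; rewrite /I/= in_itv/= andbT => /(lt_le_trans (I0 n)) x0.
    by rewrite lee_fin f0.
apply/cvg_lim => //.
have -> : (fun n => \int[@lebesgue_measure R]_(x in I n) (f x)%:E)%E =
   (fun n => (l - F n.+1%:R^-1)%:E).
  apply/funext => n; rewrite EFinB; apply: ge0_continuous_FTC2y => //.
  - by move=> x /(lt_le_trans (I0 n)); exact: f0.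
  - apply: continuous_in_subspaceT => x; rewrite inE/= in_itv/= andbT => xn.
    by apply: cf; rewrite (lt_le_trans (I0 n)).
  - by move=> x /(lt_trans (I0 n)) x0; have [] := dF _ x0.
  - apply: cvg_at_right_filter; apply/differentiable_continuous/derivable1_diffP.
    by have [] := dF _ (I0 n).
  - move=> x; rewrite in_itv/= andbT => /(lt_trans (I0 n)) x0.
    by rewrite derive1E; have [_ ->] := dF _ x0.
apply: cvg_EFin; first by near=> n.
apply: cvgB; first exact: cvg_cst.
apply: (@cvg_comp _ _ _ (fun n => n.+1%:R^-1) F); last exact: F0.
move=> A [e /= e0 HA].
have := @cvg_harmonic R => /cvgrPdist_lt/(_ _ e0)[n _ Hn].
exists n => // m /= nm; apply: HA => //=; exact: Hn.
Unshelve. all: by end_near. Qed.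

Lemma ge0_FTC0y_integrable {R : realType} (f F : R -> R) (l0 l : R) :
  (forall x : R, 0 < x -> {for x, continuous f}) ->
  (forall x : R, 0 < x -> 0 <= f x) ->
  (forall x : R, 0 < x -> is_derive x 1 F (f x)) ->
  F x @[x --> 0^'+] --> l0 -> F x @[x --> +oo] --> l ->
  (@lebesgue_measure R).-integrable `](0:R), +oo[ (EFin \o f).
Proof.
move=> cf f0 dF F0 Fl; apply/integrableP; split.
  by apply/measurable_EFinP; exact: continuous_measurable0y.
apply: (@le_lt_trans _ _ (l - l0)%:E); last exact: ltry.
rewrite -(ge0_FTC0y cf f0 dF F0 Fl) le_eqVlt; apply/orP; left; apply/eqP.
apply: eq_integral => x; rewrite inE/= in_itv/= andbT => x0.
by rewrite ger0_norm ?f0.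
Qed.

(** A change of sign of f is absorbed by adding the derivative h: both h and f + h
    fall under the nonnegative case. *)
Lemma dominated_FTC0y {R : realType} (f F h H : R -> R) (l0 l k0 k : R) :
  (forall x : R, 0 < x -> {for x, continuous f}) ->
  (forall x : R, 0 < x -> {for x, continuous h}) ->
  (forall x : R, 0 < x -> `|f x| <= h x) ->
  (forall x : R, 0 < x -> is_derive x 1 F (f x)) ->
  (forall x : R, 0 < x -> is_derive x 1 H (h x)) ->
  F x @[x --> 0^'+] --> l0 -> F x @[x --> +oo] --> l ->
  H x @[x --> 0^'+] --> k0 -> H x @[x --> +oo] --> k ->
  (@lebesgue_measure R).-integrable `](0:R), +oo[ (EFin \o f) /\
  \int[@lebesgue_measure R]_(x in `]0, +oo[) f x = l - l0.
Proof.
move=> cf ch fh dF dH F0 Fl H0 Hl.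
have h0 x : 0 < x -> 0 <= h x by move=> /fh; exact/le_trans/normr_ge0.
have ih := ge0_FTC0y_integrable ch h0 dH H0 Hl.
have If : (@lebesgue_measure R).-integrable `](0:R), +oo[ (EFin \o f).
  apply: le_integrable ih => //.
    by apply/measurable_EFinP; exact: continuous_measurable0y.
  move=> x /=; rewrite in_itv/= andbT => x0.
  by rewrite lee_fin (le_trans (fh _ x0))// ler_norm.
split => //.
have s0 x : 0 < x -> 0 <= f x + h x.
  by move=> /fh; rewrite ler_norml => /andP[+ _]; rewrite -subr_ge0 opprK.
have E : \int[@lebesgue_measure R]_(x in `]0, +oo[) (f x + h x) = (l + k) - (l0 + k0).
  rewrite /Rintegral; transitivity (fine ((l + k) - (l0 + k0))%:E) => //.
  congr fine; apply: (@ge0_FTC0y _ _ (F \+ H)) => //.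
  - by move=> x x0; apply: continuousD; [exact: cf|exact: ch].
  - by move=> x x0; have ? := dF _ x0; have ? := dH _ x0; exact: is_deriveD.
  - exact: cvgD.
  - exact: cvgD.
rewrite RintegralD// in E.
have Eh : \int[@lebesgue_measure R]_(x in `]0, +oo[) h x = k - k0.
  by rewrite /Rintegral (ge0_FTC0y ch h0 dH H0 Hl).
by move: E; rewrite Eh => E; apply: (addIr (k - k0)); rewrite E; ring.
Qed.

(** * Euler's integral *)

Lemma integrable_mulrl d (T : measurableType d) (R : realType)
    (mu : {measure set T -> \bar R}) (D : set T) (c : R) (f : T -> R) :
  measurable D -> mu.-integrable D (EFin \o f) ->
  mu.-integrable D (EFin \o (fun x => c * f x)).
Proof. by move=> mD /(integrableZl mD c); apply: eq_integrable. Qed.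

Lemma integrable_add2 d (T : measurableType d) (R : realType)
    (mu : {measure set T -> \bar R}) (D : set T) (f g : T -> R) :
  measurable D -> mu.-integrable D (EFin \o f) -> mu.-integrable D (EFin \o g) ->
  mu.-integrable D (EFin \o (fun x => f x + g x)).
Proof. by move=> mD i1 i2; have := integrableD mD i1 i2; apply: eq_integrable. Qed.

Section gamma.
Context {R : realType}.
Implicit Types (b s t c x : R).

(** A bounded increasing primitive whose derivative dominates, up to a constant, every
    integrand with the singularity of x^(b-1) at 0 and rapid decay at infinity. *)
Let hill b x : R := x `^ b / (1 + x `^ b).
Let hill' b x : R := b * x `^ (b - 1) / (1 + x `^ b) ^+ 2.

Lemma is_derive_hill b x : 0 < x -> is_derive x 1 (hill b) (hill' b x).
Proof.
move=> x0; have d := is_derive1_powR b x0.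
have nz : (cst 1 \+ (@powR R) ^~ b) x != 0.
  by rewrite /= gt_eqF// ltr_pwDl// powR_ge0.
have dD : is_derive x 1 (cst 1 \+ (@powR R) ^~ b) (0 + b * x `^ (b - 1)).
  exact: is_deriveD.
have dV := is_deriveV nz.
have -> : hill b = ((@powR R) ^~ b) \* (fun y => ((cst 1 \+ (@powR R) ^~ b) y)^-1).
  by apply/funext => y.
apply: is_derive_eq; rewrite /= /hill' /GRing.scale/=.
have nz' : 1 + x `^ b != 0 := nz.
by field.
Qed.

Lemma hill_at0 b : 0 < b -> hill b x @[x --> 0^'+] --> (0 : R).
Proof.
move=> b0; have := powR_cvg0 b0 => h.
rewrite -[X in _ --> X](mul0r (1 + 0)^-1).
apply: cvgM => //; apply: cvgV; first by rewrite addr0 oner_neq0.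
by apply: cvgD => //; exact: cvg_cst.
Qed.

Lemma powR_pinfty b : 0 < b -> x `^ b @[x --> +oo] --> +oo.
Proof.
move=> b0; apply/cvgryPgt => A.
have [A0|A0] := leP A 0.
  near=> x; have x0 : 0 < x by near: x; exact: nbhs_pinfty_gt.
  by apply: (le_lt_trans A0); rewrite powR_gt0.
near=> x; have : A `^ b^-1 < x by near: x; exact: nbhs_pinfty_gt.
move=> h; rewrite -[X in X < _]powRr1 ?ltW// -(mulVf (lt0r_neq0 b0)) powRrM.
by apply: gt0_ltr_powR => //; rewrite nnegrE ?powR_ge0// (le_trans _ (ltW h))// powR_ge0.
Unshelve. all: by end_near. Qed.

Lemma hill_pinfty b : 0 < b -> hill b x @[x --> +oo] --> (1 : R).
Proof.
move=> b0.
have -> : hill b = fun x => 1 - (1 + x `^ b)^-1.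
  apply/funext => x; have nz : 1 + x `^ b != 0 by rewrite gt_eqF// ltr_pwDl// powR_ge0.
  by rewrite /hill; field.
rewrite -[X in _ --> X]subr0; apply: cvgB; first exact: cvg_cst.
apply/cvgrPdist_lt => e e0; near=> x.
have p0 := powR_ge0 x b.
rewrite sub0r normrN ger0_norm; last by rewrite invr_ge0 addr_ge0.
have q0 : 0 < 1 + x `^ b by rewrite ltr_pwDl.
rewrite -[e]invrK ltf_pV2 ?posrE ?invr_gt0//.
apply: (@lt_trans _ _ (x `^ b)); last by rewrite ltrDr.
near: x; move: (powR_pinfty b0) => /cvgryPgt; exact.
Unshelve. all: by end_near. Qed.

(** Split at 1; beyond 1, replace b by an integer and use one term of the
    exponential series. *)
Lemma powR_poly_le_expR b : 0 < b ->
  exists2 C : R, 0 < C & forall x, 0 < x -> (1 + x) * (1 + x `^ b) ^+ 2 * expR (- x) <= C.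
Proof.
move=> b0; have [m bm] : exists m : nat, b <= m%:R.
  by exists (Num.truncn b).+1; rewrite ltW// truncnS_gt.
exists (8 + 8 * (m.*2.+1)`!%:R) => [|x x0].
  by rewrite ltr_pwDl// mulr_ge0.
rewrite expRN ler_pdivrMr ?expR_gt0//.
have p0 := powR_ge0 x b.
have [x1|x1] := leP x 1.
  have px : x `^ b <= 1.
    rewrite -[leRHS](powRr0 x); apply: ger_powR; last exact: ltW.
    by rewrite x0 x1.
  apply: (@le_trans _ _ 8).
    rewrite -[leRHS]/((8 : R)) (_ : 8 = 2 * 2 ^+ 2 :> R); last by ring.
    apply: ler_pM; rewrite ?addr_ge0 ?(ltW x0)// ?exprn_ge0 ?addr_ge0//; first lra.
    by apply: lerXn2r; rewrite ?nnegrE ?addr_ge0//; lra.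
  apply: (@le_trans _ _ (8 * expR x)).
    by rewrite ler_pMr// -expR0 ler_expR ltW.
  by rewrite ler_pM2r ?expR_gt0// lerDl mulr_ge0.
have px : x `^ b <= x ^+ m.
  by rewrite -powR_mulrn ?(ltW x0)//; exact: (ler_powR (ltW x1) bm).
have xm1 : 1 <= x ^+ m by rewrite exprn_ege1// ltW.
apply: (@le_trans _ _ (8 * x ^+ m.*2.+1)).
  rewrite (_ : 8 * _ = (2 * x) * (2 * x ^+ m) ^+ 2); last first.
    by rewrite -addnn exprS exprD; ring.
  apply: ler_pM; rewrite ?addr_ge0 ?(ltW x0)// ?exprn_ge0 ?addr_ge0//; first lra.
  by apply: lerXn2r; rewrite ?nnegrE ?mulr_ge0 ?addr_ge0 ?exprn_ge0 ?(ltW x0)//; lra.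
have f0 : 0 < (m.*2.+1)`!%:R :> R by rewrite ltr0n fact_gt0.
have := expR_ge1Dxn m.*2 (ltW x0) => h.
have h2 : x ^+ m.*2.+1 <= (m.*2.+1)`!%:R * expR x.
  rewrite -ler_pdivrMl// mulrC (le_trans _ h)// lerDr//.
have := expR_gt0 x; nra.
Qed.

Lemma continuous_powR b x : 0 < x -> {for x, continuous ((@powR R) ^~ b)}.
Proof.
move=> x0; apply: differentiable_continuous; apply/derivable1_diffP.
by apply: derivable_powR; rewrite in_itv/= x0.
Qed.

Lemma continuous_hill' b x : 0 < x -> {for x, continuous (hill' b)}.
Proof.
move=> x0; rewrite /hill'.
have nz : 1 + x `^ b != 0 by rewrite gt_eqF// ltr_pwDl// powR_ge0.
apply: cvgM; first by apply: cvgM; [exact: cvg_cst|exact: continuous_powR].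
apply: cvgV; first by rewrite expf_neq0.
rewrite expr2; under eq_fun do rewrite expr2.
by apply: cvgM; apply: cvgD; try exact: cvg_cst; exact: continuous_powR.
Qed.

Lemma continuous_expRN : continuous (fun x => expR (- x)).
Proof.
move=> x; apply: (@continuous_comp _ _ _ -%R expR); first exact: opp_continuous.
exact: continuous_expR.
Qed.

Lemma continuous_gammaint b x : 0 < x ->
  {for x, continuous (fun x => x `^ b * expR (- x))}.
Proof.
by move=> x0; apply: cvgM; [exact: continuous_powR|exact: continuous_expRN].
Qed.

Lemma gamma_integrand_le b : 0 < b -> exists2 C : R, 0 < C & forall x, 0 < x ->
  (1 + x) * (x `^ (b - 1) * expR (- x)) <= C * hill' b x.
Proof.
move=> b0; have [C C0 HC] := powR_poly_le_expR b0.
exists (C / b) => [|x x0]; first by rewrite divr_gt0.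
have p0 : 0 < 1 + x `^ b by rewrite ltr_pwDl// powR_ge0.
rewrite /hill' [leRHS](_ : _ = x `^ (b - 1) * (C / (1 + x `^ b) ^+ 2)); last first.
  by field; rewrite !gt_eqF.
rewrite mulrCA ler_pM2l ?powR_gt0// ler_pdivlMr ?exprn_gt0//.
by rewrite mulrAC HC.
Qed.

Let gamma_integrand b x : R := x `^ (b - 1) * expR (- x).

(** Integrability and the functional equation come together, from integrating
    the derivative of x^b exp(-x). *)
Lemma Gamma_FTC b : 0 < b ->
  (@lebesgue_measure R).-integrable `](0:R), +oo[ (EFin \o gamma_integrand b) /\
  (@lebesgue_measure R).-integrable `](0:R), +oo[ (EFin \o gamma_integrand (b + 1)) /\
  Gamma (b + 1) = b * Gamma b.
Proof.
move=> b0; have [C C0 HC] := gamma_integrand_le b0.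
have mg c : measurable_fun `](0:R), +oo[ (gamma_integrand c).
  by apply: continuous_measurable0y => x x0; exact: continuous_gammaint.
have h0 x : 0 < x -> 0 <= hill' b x.
  by move=> x0; rewrite divr_ge0 ?exprn_ge0 ?addr_ge0 ?mulr_ge0 ?powR_ge0// ltW.
have ih := ge0_FTC0y_integrable (@continuous_hill' b) h0 (@is_derive_hill b) (hill_at0 b0)
  (hill_pinfty b0).
have ich : (@lebesgue_measure R).-integrable `](0:R), +oo[ (EFin \o (fun x => C * hill' b x)).
  exact: integrable_mulrl.
have i1 : (@lebesgue_measure R).-integrable `](0:R), +oo[ (EFin \o gamma_integrand b).
  apply: le_integrable ich => //; first by apply/measurable_EFinP; exact: mg.
  move=> x /=; rewrite in_itv/= andbT => x0; rewrite lee_fin ger0_norm; last first.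
    by rewrite mulr_ge0 ?powR_ge0 ?expR_ge0.
  rewrite (le_trans _ (ler_norm _))//; apply: le_trans (HC _ x0).
  by rewrite ler_peMl ?mulr_ge0 ?powR_ge0 ?expR_ge0// lerDl ltW.
have giS x : 0 < x -> gamma_integrand (b + 1) x = x * gamma_integrand b x.
  by move=> x0; rewrite /gamma_integrand mulrA mulr_powRB1 ?(ltW x0)// addrK.
have i2 : (@lebesgue_measure R).-integrable `](0:R), +oo[ (EFin \o gamma_integrand (b + 1)).
  apply: le_integrable ich => //; first by apply/measurable_EFinP; exact: mg.
  move=> x /=; rewrite in_itv/= andbT => x0; rewrite lee_fin ger0_norm; last first.
    by rewrite mulr_ge0 ?powR_ge0 ?expR_ge0.
  rewrite giS// (le_trans _ (ler_norm _))//; apply: le_trans (HC _ x0).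
  by rewrite ler_wpM2r ?mulr_ge0 ?powR_ge0 ?expR_ge0// lerDr.
split => //; split => //.
pose D := b + 1.
have := @dominated_FTC0y R (fun x => b * gamma_integrand b x - gamma_integrand (b + 1) x)
  (fun x => x `^ b * expR (- x)) (fun x => (D * C) * hill' b x) (fun x => (D * C) *
    hill b x) 0 0 (D * C * 0) (D * C * 1).
case.
- move=> x x0; apply: cvgB; first by apply: cvgM; [exact: cvg_cst|exact: continuous_gammaint].
  exact: continuous_gammaint.
- by move=> x x0; apply: cvgM; [exact: cvg_cst|exact: continuous_hill'].
- move=> x x0; apply: (le_trans (ler_normB _ _)).
  have g0 : 0 <= gamma_integrand b x by rewrite mulr_ge0 ?powR_ge0 ?expR_ge0.
  rewrite giS// (ger0_norm (mulr_ge0 (ltW b0) g0)) (ger0_norm (mulr_ge0 (ltW x0) g0)).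
  rewrite -mulrA; apply: (@le_trans _ _ (D * ((1 + x) * gamma_integrand b x))); last first.
    by rewrite ler_pM2l ?HC// /D ltr_wpDl// ltW.
  by rewrite -mulrDl mulrA ler_wpM2r// /D; nra.
- move=> x x0; have d := is_derive1_powR b x0.
  apply: is_derive_eq; rewrite /GRing.scale/=.
  by rewrite giS// /gamma_integrand -(mulr_powRB1 (ltW x0) b0); ring.
- move=> x x0; have d := is_derive_hill b x0.
  by apply: is_derive_eq; rewrite /GRing.scale/=; ring.
- rewrite -[X in _ --> X](mul0r (expR (- 0))); apply: cvgM; first exact: powR_cvg0.
  by apply: cvg_at_right_filter; exact: continuous_expRN.
- have [B B0 HB] := powR_poly_le_expR b0.
  apply/cvgrPdist_lt => e e0; near=> x.
  have x0 : 0 < x by near: x; exact: nbhs_pinfty_gt.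
  have xe : B / e < x by near: x; apply: nbhs_pinfty_gt; exact: num_real.
  have p0 := powR_ge0 x b; have q0 := expR_ge0 (- x).
  rewrite sub0r normrN ger0_norm ?mulr_ge0//.
  have h := HB _ x0; rewrite ltr_pdivrMr// in xe.
  have : x * (x `^ b * expR (- x)) <= B.
    apply: le_trans h; rewrite mulrA ler_wpM2r//; apply: ler_pM; rewrite ?(ltW x0)//.
      by rewrite lerDr.
    by nra.
  by move=> /le_lt_trans/(_ xe); rewrite ltr_pM2l.
- by apply: cvgM; [exact: cvg_cst|exact: hill_at0].
- by apply: cvgM; [exact: cvg_cst|exact: hill_pinfty].
move=> _; rewrite subrr => E.
rewrite RintegralB//= in E; last exact: integrable_mulrl.
rewrite RintegralZl// in E.
by apply/esym/subr0_eq; exact: E.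
Unshelve. all: by end_near. Qed.
End gamma.

(** * Euler's limit formula *)

Section gamma_limit.
Context {R : realType}.
Implicit Types (b s t c x y : R).

(** The concave power lies below its tangent at 1; here from ln z <= z - 1 applied
    at y / u and 1 / u, where u is the right-hand side. *)
Lemma powR_le_tangent t y : 0 <= t <= 1 -> 0 < y -> y `^ t <= 1 - t + t * y.
Proof.
move=> /andP[t0 t1] y0; pose u := 1 - t + t * y.
have u0 : 0 < u by rewrite /u; nra.
have lnu (z : R) : 0 < z -> ln z <= z - 1.
  by move=> z0; have := @le_ln1Dx R (z - 1); rewrite (_ : 1 + (z - 1) = z); [by apply; lra|ring].
rewrite -/u -ler_ln ?posrE ?powR_gt0// ln_powR.
have h1 := lnu (y / u) (divr_gt0 y0 u0).
have h2 := lnu (u^-1); rewrite invr_gt0 in h2; have {}h2 := h2 u0.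
rewrite ln_div ?posrE// in h1; rewrite lnV ?posrE// in h2.
have h3 : t * (y / u - 1) + (1 - t) * (u^-1 - 1) = 0.
  have nz : 1 - t + t * y != 0 by rewrite gt_eqF.
  by rewrite /u; field.
by nra.
Qed.

Lemma Gamma1 : Gamma 1 = 1 :> R.
Proof.
rewrite /Gamma /Rintegral.
transitivity (fine (0 - (- expR (- 0)) : R)%:E); last by rewrite /= oppr0 expR0 opprK add0r.
congr fine; apply: (@ge0_FTC0y R _ (fun x => - expR (- x))).
- by move=> x x0; exact: continuous_gammaint.
- by move=> x x0; rewrite mulr_ge0 ?powR_ge0 ?expR_ge0.
- move=> x x0; apply: is_derive_eq; rewrite /GRing.scale/=.
  by rewrite subrr powRr0; ring.
- by apply: cvgN; apply: cvg_at_right_filter; exact: continuous_expRN.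
- rewrite -oppr0; apply: cvgN; apply/cvgrPdist_lt => e e0; near=> x.
  have xe : e^-1 < x by near: x; apply: nbhs_pinfty_gt; exact: num_real.
  have x0 : 0 < x by apply: lt_trans xe; rewrite invr_gt0.
  rewrite sub0r normrN ger0_norm ?expR_ge0// expRN -[e]invrK.
  rewrite ltf_pV2 ?posrE ?invr_gt0 ?expR_gt0//.
  apply: (lt_le_trans xe); apply: le_trans (expR_ge1Dx x).
  by rewrite lerDr.
Unshelve. all: by end_near. Qed.

Lemma Gamma_ge0 b : 0 <= Gamma b.
Proof. by apply: Rintegral_ge0 => x _; rewrite mulr_ge0 ?powR_ge0 ?expR_ge0. Qed.

Lemma Gamma_addr1 b : 0 < b -> Gamma (b + 1) = b * Gamma b.
Proof. by move=> /Gamma_FTC[_ []]. Qed.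

Lemma Gamma_nat n : Gamma (n%:R + 1) = n`!%:R :> R.
Proof.
elim: n => [|n ih]; first by rewrite add0r Gamma1.
by rewrite Gamma_addr1 ?ltr0n// -natr1 ih factS natrM -natr1.
Qed.

(** A weak form of log-convexity: insert the tangent inequality at x / s under the
    integral. *)
Lemma Gamma_le s t : 0 < s -> 0 <= t <= 1 -> Gamma (s + t) <= s `^ t * Gamma s.
Proof.
move=> s0 /andP[t0 t1].
have st0 : 0 < s + t by rewrite ltr_pwDl.
have [i1 [i2 E]] := Gamma_FTC s0; have [i3 _] := Gamma_FTC st0.
have -> : s `^ t * Gamma s =
   s `^ t * (1 - t) * Gamma s + s `^ t * t / s * Gamma (s + 1).
  by rewrite E; field; rewrite gt_eqF.
rewrite /Gamma -!RintegralZl// -RintegralD//; [|exact: integrable_mulrl..].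
apply: le_Rintegral => //.
  by apply: integrable_add2 => //; exact: integrable_mulrl.
move=> x /=; rewrite in_itv/= andbT => x0.
have -> : x `^ (s + 1 - 1) = x * x `^ (s - 1).
  by rewrite addrK mulr_powRB1// ltW.
have -> : x `^ (s + t - 1) = x `^ (s - 1) * x `^ t.
  by rewrite -powRD ?(gt_eqF x0) ?implybT//; congr (_ `^ _); ring.
have -> : x `^ t = s `^ t * (x / s) `^ t.
  rewrite -powRM ?(ltW s0) ?divr_ge0 ?(ltW x0) ?(ltW s0)//.
  by congr (_ `^ _); field; rewrite gt_eqF.
rewrite [leRHS](_ : _ = x `^ (s - 1) * expR (- x) * (s `^ t * (1 - t + t * (x / s)))); last first.
  by field; rewrite gt_eqF.
rewrite -mulrA [leLHS](_ : _ = x `^ (s - 1) * expR (- x) * (s `^ t * (x / s) `^ t)); last by ring.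
rewrite ler_wpM2l ?mulr_ge0 ?powR_ge0 ?expR_ge0// ler_wpM2l ?powR_ge0//.
by apply: powR_le_tangent; rewrite ?t0 ?divr_gt0.
Qed.

Lemma Gamma_gt0 b : 0 < b -> 0 < Gamma b.
Proof.
move=> b0; rewrite lt_neqAle Gamma_ge0 andbT; apply/negP => /eqP E.
have /andP[] := truncn_itv (ltW b0); set n := Num.truncn b => nb bn.
have := @Gamma_le b (n.+1%:R - b) b0; rewrite -E mulr0 (_ : b + (n.+1%:R - b) = n.+1%:R);
  last by ring.
move=> h.
have : Gamma (n.+1%:R : R) <= 0 by apply: h; rewrite -natr1; rewrite -natr1 in bn; lra.
by rewrite -natr1 Gamma_nat lern0 => /eqP f0; have := fact_gt0 n; rewrite f0.
Qed.

(** The coefficient of z^n in (1-z)^(-b). *)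
Definition negbin b n : R := \prod_(i < n) ((b + i%:R) / i.+1%:R).

Lemma negbin0 b : negbin b 0 = 1. Proof. by rewrite /negbin big_ord0. Qed.

Lemma negbinS b n : negbin b n.+1 = negbin b n * ((b + n%:R) / n.+1%:R).
Proof. by rewrite /negbin big_ord_recr. Qed.

Lemma Gamma_negbin b n : 0 < b ->
  Gamma (b + n%:R) = negbin b n * Gamma b * Gamma (n%:R + 1).
Proof.
move=> b0; elim: n => [|n ih]; first by rewrite negbin0 addr0 add0r Gamma1 mul1r mulr1.
have bn : 0 < b + n%:R by rewrite ltr_pwDl.
rewrite -[X in b + X]natr1 addrA (Gamma_addr1 bn) ih.
rewrite (Gamma_addr1 (ltr0Sn R n)) negbinS -natr1.
by field; rewrite natr1 pnatr_eq0.
Qed.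

Lemma negbin_gt0 b n : 0 < b -> 0 < negbin b n.
Proof. by move=> b0; apply: prodr_gt0 => i _; rewrite divr_gt0 ?ltr_pwDl. Qed.

(** For b in ]0, 1] the bound [Gamma_le], used from n and from n + b, squeezes the
    sequence; the functional equation carries the limit from b - 1 to b. *)
Lemma negbin_cvg b : 0 < b ->
  (negbin b n.+1 * n.+1%:R `^ (1 - b)) @[n --> \oo] --> (Gamma b)^-1.
Proof.
move=> b0.
have [m bm] : exists m : nat, m%:R < b <= m.+1%:R.
  have /andP[] := truncn_itv (ltW b0); set n := Num.truncn b => nb bn.
  move: nb; rewrite le_eqVlt => /predU1P[nb|nb].
    have n0 : (0 < n)%N by rewrite -(ltr0n R) nb.
    by exists n.-1; rewrite prednK// -nb lexx ltr_nat prednK// leqnn.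
  by exists n; rewrite nb ltW.
elim: m b b0 bm => [|m ih] b b0 /andP[mb bm].
  have lo n : (n.+1%:R / (n.+1%:R + b)) `^ (1 - b) / Gamma b <=
      negbin b n.+1 * n.+1%:R `^ (1 - b).
    have h := @Gamma_le (b + n.+1%:R) (1 - b).
    have {h} : Gamma (n.+1%:R + 1) <= (b + n.+1%:R) `^ (1 - b) * (negbin b n.+1 * Gamma b *
      Gamma (n.+1%:R + 1)).
      rewrite -Gamma_negbin//; apply: le_trans (h _ _).
      - by rewrite (_ : b + n.+1%:R + (1 - b) = n.+1%:R + 1)//; ring.
      - by rewrite ltr_pwDl.
      - by lra.
    have G0 : 0 < Gamma (n.+1%:R + 1 : R) by apply: Gamma_gt0.
    rewrite -[leLHS]mul1r mulrA ler_pM2r// => h.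
    rewrite ler_pdivrMr ?Gamma_gt0// powRM ?invr_ge0 ?addr_ge0 ?(ltW b0)//.
    rewrite -powR_inv1 ?addr_ge0 ?(ltW b0)// powRAC powR_inv1 ?powR_ge0//.
    rewrite mulrAC [leRHS]mulrC ler_wpM2l ?powR_ge0// -[leLHS]mul1r.
    by rewrite ler_pdivrMr ?powR_gt0 ?ltr_wpDl// mulrC (addrC _ b).
  have hi n : negbin b n.+1 * n.+1%:R `^ (1 - b) <= (Gamma b)^-1.
    have := @Gamma_le n.+1%:R b (ltr0Sn _ _); rewrite addrC Gamma_negbin//.
    rewrite Gamma_addr1// (ltW b0) bm => /(_ isT).
    have G0 : 0 < Gamma (n.+1%:R : R) by apply: Gamma_gt0.
    rewrite mulrA ler_pM2r// => h.
    rewrite -[leRHS]mul1r ler_pdivlMr ?Gamma_gt0// mulrAC.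
    rewrite powRB ?pnatr_eq0 ?implybT// powRr1// mulrA.
    by rewrite ler_pdivrMr ?powR_gt0// mul1r.
  apply: (squeeze_cvgr (f := fun n => (n.+1%:R / (n.+1%:R + b)) `^ (1 - b) / Gamma b) (h :=
    fun=> (Gamma b)^-1)).
  - by near=> n; rewrite lo hi.
  - rewrite -[X in _ --> X]mul1r; apply: cvgM; last exact: cvg_cst.
    rewrite -[X in _ --> X](_ : 1 `^ (1 - b) = 1); last by rewrite powR1.
    apply: (@cvg_comp _ _ _ (fun n : nat => n.+1%:R / (n.+1%:R + b))
      ((@powR R) ^~ (1 - b)) _ (nbhs (1 : R))); last first.
      have h := @continuous_powR R (1 - b) 1 ltr01. refine h.
    have -> : (fun n : nat => n.+1%:R / (n.+1%:R + b)) = (fun n => (1 + b * n.+1%:R^-1)^-1).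
      apply/funext => n; field.
      by rewrite nat1r pnatr_eq0/= gt_eqF// ltr_wpDr// ltW.
    have L : (1 + b * n.+1%:R^-1) @[n --> \oo] --> (1 : R).
      rewrite -[X in _ --> X](addr0 1) -[X in _ --> _ + X](mulr0 b); apply: cvgD;
        first exact: cvg_cst.
      by apply: cvgM; [exact: cvg_cst|exact: cvg_harmonic].
    have h := cvgV (oner_neq0 R) L; rewrite invr1 in h; exact: h.
  - exact: cvg_cst.
have c0 : 0 < b - 1 by rewrite -natr1 in mb; have := ler0n R m; lra.
have {ih} := ih (b - 1) c0; rewrite -natr1 in mb; rewrite -(natr1 m.+1) in bm.
rewrite ltrBrDr mb lerBlDr bm => /(_ isT) ih.
have -> : Gamma b = (b - 1) * Gamma (b - 1) by rewrite -(Gamma_addr1 c0) subrK.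
rewrite invfM mulrC.
have -> : (fun n => negbin b n.+1 * n.+1%:R `^ (1 - b)) =
   (fun n => (negbin (b - 1) n.+1 * n.+1%:R `^ (1 - (b - 1))) * ((b - 1)^-1 + n.+1%:R^-1)).
  apply/funext => n.
  have E k : negbin b k = negbin (b - 1) k * ((b - 1 + k%:R) / (b - 1)).
    elim: k => [|k ihk]; first by rewrite !negbin0 addr0 divff ?mulr1// gt_eqF.
    rewrite !negbinS ihk -natr1; field.
    by rewrite natr1 pnatr_eq0 gt_eqF.
  rewrite E opprB addrA [1 + 1 - b](_ : _ = (1 - b) + 1); last by ring.
  rewrite (@powRD _ _ (1 - b) 1) ?pnatr_eq0 ?implybT// powRr1//.
  by field; rewrite nat1r pnatr_eq0/= gt_eqF.
have L : ((b - 1)^-1 + n.+1%:R^-1) @[n --> \oo] --> (b - 1)^-1.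
  rewrite -[X in _ --> X]addr0; apply: cvgD; first exact: cvg_cst.
  exact: cvg_harmonic.
exact: (cvgM ih L).
Unshelve. all: by end_near. Qed.

End gamma_limit.

(** * The discrete Mittag-Leffler functions *)

Lemma cvg_sumr {R : realType} (I : Type) (s : seq I) (f : I -> nat -> R) (l : I -> R) :
  (forall i, f i n @[n --> \oo] --> l i) ->
  \sum_(i <- s) f i n @[n --> \oo] --> \sum_(i <- s) l i.
Proof.
move=> fl; elim: s => [|i s ih].
  by rewrite big_nil; under eq_fun do rewrite big_nil; exact: cvg_cst.
by rewrite big_cons; under eq_fun do rewrite big_cons; exact: cvgD.
Qed.

Section discrete.
Context {R : realType}.
Implicit Types (b c q : R).

Lemma negbin_mulS b n : n.+1%:R * negbin b n.+1 = (b + n%:R) * negbin b n.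
Proof. by rewrite negbinS; field; rewrite nat1r pnatr_eq0. Qed.

Lemma negbin0S n : negbin (0 : R) n.+1 = 0.
Proof. by rewrite /negbin big_ord_recl/= add0r mul0r mul0r. Qed.

Lemma negbin1 n : negbin (1 : R) n = 1.
Proof.
elim: n => [|n ih]; first by rewrite negbin0.
by rewrite negbinS ih mul1r nat1r divff// pnatr_eq0.
Qed.

(** Chu-Vandermonde, that is (1-z)^(-b) (1-z)^(-c) = (1-z)^(-(b+c)). Induction on n, by
    applying z d/dz to both sides. *)
Lemma negbin_conv b c n :
  \sum_(j < n.+1) negbin b j * negbin c (n - j) = negbin (b + c) n.
Proof.
elim: n => [|n ih]; first by rewrite big_ord1 !negbin0 mulr1.
have n0 : n.+1%:R != 0 :> R by rewrite pnatr_eq0.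
apply: (mulfI n0); rewrite negbin_mulS -ih mulr_sumr.
transitivity (\sum_(j < n.+2) (j%:R * negbin b j * negbin c (n.+1 - j) +
    negbin b j * ((n.+1 - j)%:R * negbin c (n.+1 - j)))).
  apply: eq_bigr => j _; rewrite natrB; first by ring.
  by rewrite -ltnS.
rewrite big_split/= big_ord_recl/= !mul0r add0r.
rewrite [X in _ + X]big_ord_recr/= subnn mul0r mulr0 addr0 -big_split/= mulr_sumr.
apply: eq_bigr => j _; have jn : (j <= n)%N by rewrite -ltnS.
rewrite /bump leq0n add1n subSS negbin_mulS subSn// negbin_mulS natrB//.
by ring.
Qed.

Lemma negbin_sum b n : \sum_(j < n.+1) negbin b j = negbin (b + 1) n.
Proof. by rewrite -negbin_conv; apply: eq_bigr => j _; rewrite negbin1 mulr1. Qed.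

Lemma negbin_norm b n : `|negbin b n| <= (1 + `|b|) ^+ n.
Proof.
elim: n => [|n ih]; first by rewrite negbin0 normr1.
rewrite negbinS normrM exprSr ler_pM// normrM normfV ler_pdivrMr ?normr_gt0 ?pnatr_eq0//.
apply: le_trans (ler_normD _ _) _; rewrite !normr_nat -natr1.
have := normr_ge0 b; have := ler0n R n; nra.
Qed.

(** Write q = exp(-2 mu): one factor exp(-mu k) beats the power of k, the other
    remains. *)
Lemma poly_geometric q n : 0 < q < 1 ->
  exists C r : R, [/\ 0 <= C, 0 < r, r < 1 &
    forall k : nat, q ^+ k * (k%:R + 2) ^+ n <= C * r ^+ k].
Proof.
move=> /andP[q0 q1]; pose mu := - ln q / 2.
have mu0 : 0 < mu by have := ln_lt0 (introT andP (conj q0 q1)); rewrite /mu; lra.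
exists (n`!%:R / mu ^+ n * expR (mu * 2)), (expR (- mu)); split.
- by rewrite !mulr_ge0 ?invr_ge0 ?exprn_ge0 ?expR_ge0 ?(ltW mu0).
- exact: expR_gt0.
- by rewrite expR_lt1 oppr_lt0.
move=> k.
have qE : q = expR (- mu) * expR (- mu).
  by rewrite -expRD -[LHS]lnK ?posrE//; congr expR; rewrite /mu; field.
have h : (mu * (k%:R + 2)) ^+ n <= n`!%:R * expR (mu * (k%:R + 2)).
  have x0 : 0 <= mu * (k%:R + 2) by rewrite mulr_ge0 ?(ltW mu0).
  have f0 : 0 < n`!%:R :> R by rewrite ltr0n fact_gt0.
  case: (n) f0 => [|m] f0.
    by rewrite expr0 fact0 mul1r; apply: le_trans (expR_ge1Dx _); rewrite lerDl.
  rewrite -ler_pdivrMl// mulrC; apply: le_trans (expR_ge1Dxn m x0).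
  by rewrite lerDr.
rewrite exprMn in h.
have {}h : (k%:R + 2) ^+ n <= n`!%:R / mu ^+ n * expR (mu * (k%:R + 2)).
  by rewrite mulrAC ler_pdivlMr ?exprn_gt0// mulrC.
apply: (@le_trans _ _ (q ^+ k * (n`!%:R / mu ^+ n * expR (mu * (k%:R + 2))))).
  by rewrite ler_pM2l// exprn_gt0.
rewrite le_eqVlt; apply/orP; left; apply/eqP.
rewrite qE exprMn mulrDr expRD [mu * k%:R]mulrC expRM_natl.
have e : expR (- mu) ^+ k * expR mu ^+ k = 1.
  by rewrite -exprMn -expRD addNr expR0 expr1n.
transitivity ((expR (- mu) ^+ k * expR mu ^+ k) * (expR (- mu) ^+ k * (n`!%:R / mu ^+ n *
  expR (mu * 2)))); first by ring.
by rewrite e; ring.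
Qed.

Variables (a lam : R).
Hypotheses (a0 : 0 < a) (a1 : a < 1) (l0 : 0 < lam) (l1 : lam < 1).

(** The coefficient of z^n in (1-z)^(-c) / (1 + lam (1-z)^(-a)), expanded in powers of
    lam. With lam = h^a it is, up to a power of h, the value at n h of a discrete
    analogue of t^(c-1) E_(a,c)(-t^a). *)
Definition discrete_ml_term c n (k : nat) : R := (- lam) ^+ k * negbin (a * k%:R + c) n.
Definition discrete_ml c n : R := limn (series (discrete_ml_term c n)).

Lemma discrete_ml_cvg c n : `|c| <= 2 -> series (discrete_ml_term c n) @ \oo --> discrete_ml c n.
Proof.
move=> c1; suff : cvgn (series (discrete_ml_term c n)) by [].
have [C [r [C0 r0 r1 H]]] := @poly_geometric lam n (introT andP (conj l0 l1)).
apply: normed_cvg.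
apply: (@series_le_cvg _ _ (geometric (2 ^+ n * C) r)).
- by move=> k /=.
- by move=> k; rewrite /geometric/= mulr_ge0 ?mulr_ge0 ?exprn_ge0// ltW.
- move=> k; rewrite /geometric/= /discrete_ml_term normrM normrX normrN (gtr0_norm l0).
  rewrite -mulrA; apply: (@le_trans _ _ (2 ^+ n * (lam ^+ k * (k%:R + 2) ^+ n))); last first.
    by rewrite ler_pM2l ?exprn_gt0.
  rewrite mulrCA ler_pM2l ?exprn_gt0// -exprMn.
  apply: (le_trans (negbin_norm _ _)); apply: lerXn2r; rewrite ?nnegrE ?addr_ge0 ?mulr_ge0//.
  have : `|a * k%:R + c| <= k%:R + 2.
    apply: (le_trans (ler_normD _ _)); rewrite normrM (gtr0_norm a0) normr_nat.
    have ak : a * k%:R <= k%:R by rewrite ler_piMl// ltW.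
    lra.
  have := ler0n R k; lra.
- by apply: is_cvg_geometric_series; rewrite ger0_norm ?ltW.
Qed.

(** Multiplication of the generating series by (1-z)^(-b). *)
Lemma discrete_ml_conv b c n : `|c| <= 2 -> `|c + b| <= 2 ->
  \sum_(j < n.+1) negbin b j * discrete_ml c (n - j) = discrete_ml (c + b) n.
Proof.
move=> hc hcb.
have L : (fun m => \sum_(j < n.+1) negbin b j * series (discrete_ml_term c (n - j)) m) @ \oo -->
   \sum_(j < n.+1) negbin b j * discrete_ml c (n - j).
  apply: cvg_sumr => j; apply: cvgM; first exact: cvg_cst.
  exact: discrete_ml_cvg.
apply/esym; rewrite /discrete_ml; apply/cvg_lim => //.
apply: cvg_trans L; apply: near_eq_cvg; near=> m.
rewrite /series/= [LHS](eq_bigr (fun j : 'I_n.+1 => \sum_(0 <= k < m) negbin b j *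
  discrete_ml_term c (n - j) k)); last first.
  by move=> j _; rewrite mulr_sumr.
rewrite exchange_big/=; apply: eq_bigr => k _; rewrite /discrete_ml_term.
rewrite (_ : a * k%:R + (c + b) = b + (a * k%:R + c)); last by ring.
by rewrite -negbin_conv mulr_sumr; apply: eq_bigr => j _; rewrite mulrCA.
Unshelve. all: by end_near. Qed.

(** The generating series F satisfies F (1 + lam (1-z)^(-a)) = (1-z)^(-c); on the
    expansion in lam this is a telescoping sum. *)
Lemma discrete_ml_shift c n : `|c| <= 2 -> `|c + a| <= 2 ->
  discrete_ml c n + lam * discrete_ml (c + a) n = negbin c n.
Proof.
move=> hc hca.
have L : (fun m => series (discrete_ml_term c n) m.+1 + lam * series (discrete_ml_term (c +
  a) n) m) @ \oo -->
   discrete_ml c n + lam * discrete_ml (c + a) n.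
  apply: cvgD; first by rewrite (cvg_shiftS (series (discrete_ml_term c n)));
    exact: discrete_ml_cvg.
  by apply: cvgM; [exact: cvg_cst|exact: discrete_ml_cvg].
have <- := cvg_lim (@Rhausdorff R) L.
apply/cvg_lim => //; apply: cvg_near_cst; near=> m.
rewrite /series/= big_nat_recl//= mulr_sumr /discrete_ml_term -addrA -big_split/=.
rewrite big1 ?addr0; first by rewrite mulr0 add0r expr0 mul1r.
move=> k _; rewrite exprS -natr1.
rewrite (_ : a * (k%:R + 1) + c = a * k%:R + (c + a)); last by ring.
by ring.
Unshelve. all: by end_near. Qed.

Let ca : `|a| <= 2. Proof. by rewrite gtr0_norm//; have := a1; lra. Qed.
Let ca1 : `|a - 1| <= 2. Proof. by rewrite ler_norml; have := a1; have := a0 => ? ?;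
  apply/andP; split; lra. Qed.
Let c1 : `|1 : R| <= 2. Proof. by rewrite normr1; lra. Qed.
Let c0 : `|0 : R| <= 2. Proof. by rewrite normr0; lra. Qed.
Let cS : `|1 + a| <= 2. Proof. by have := a1; have := a0 => ? ?; rewrite gtr0_norm; lra. Qed.

(** A and B are the coefficients of (1-z)^(a-1) + lam (1-z)^(-1) and of its inverse. *)
Let A j := negbin (1 - a) j + lam.
Let B n := discrete_ml (a - 1) n.

Let AB n : \sum_(j < n.+1) A j * B (n - j) = (n == 0)%:R.
Proof.
transitivity (discrete_ml 0 n + lam * discrete_ml (0 + a) n); last first.
  rewrite discrete_ml_shift//; last by rewrite add0r.
  by case: n => [|n]; rewrite ?negbin0 ?negbin0S.
have e0 : (a - 1) + (1 - a) = 0 by ring.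
have e1 : (a - 1) + 1 = 0 + a by ring.
have h0 := @discrete_ml_conv (1 - a) (a - 1) n ca1; rewrite e0 in h0; rewrite -(h0 c0).
have h1 := @discrete_ml_conv 1 (a - 1) n ca1; rewrite e1 add0r in h1.
rewrite add0r -(h1 ca) mulr_sumr -big_split/=; apply: eq_bigr => j _.
by rewrite negbin1 mul1r /A mulrDl.
Qed.

Let negbin_nincr m n : (m <= n)%N -> negbin (1 - a) n <= negbin (1 - a) m.
Proof.
move=> /subnK <-; elim: (n - m)%N => [//|k ih].
rewrite addSn negbinS; apply: le_trans ih.
have := @negbin_gt0 R (1 - a) (k + m) ltac:(have := a1; lra) => h.
rewrite ger_pMr// ler_pdivrMr ?ltr0n// -natr1; have := a0; lra.
Qed.

Let A_gt0 j : 0 < A j.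
Proof. by rewrite /A addr_gt0// negbin_gt0//; have := a1; lra. Qed.

Let A_logconvex m n : (m <= n)%N -> A m.+1 * A n <= A n.+1 * A m.
Proof.
move=> mn; rewrite /A !negbinS.
have pm := @negbin_gt0 R (1 - a) m ltac:(have := a1; lra).
have pn := @negbin_gt0 R (1 - a) n ltac:(have := a1; lra).
have pnm := negbin_nincr mn.
move: pm pn pnm; set x := negbin _ m; set y := negbin _ n => x0 y0 yx.
have -> : (1 - a + m%:R) / m.+1%:R = 1 - a / m.+1%:R.
  by rewrite -natr1; field; rewrite natr1 pnatr_eq0.
have -> : (1 - a + n%:R) / n.+1%:R = 1 - a / n.+1%:R.
  by rewrite -natr1; field; rewrite natr1 pnatr_eq0.
have : a / n.+1%:R <= a / m.+1%:R.
  by rewrite ler_pM2l// lef_pV2 ?posrE ?ltr0n// ler_nat ltnS.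
have : 0 < a / n.+1%:R by rewrite divr_gt0.
set u := a / n.+1%:R; set v := a / m.+1%:R => u0 uv.
have h1 : y * u <= x * v by apply: ler_pM => //; exact: ltW.
have h2 : 0 <= (x * y) * (v - u) by rewrite mulr_ge0 ?subr_ge0// ltW// mulr_gt0.
have h3 : 0 <= lam * (x * v - y * u) by rewrite mulr_ge0 ?subr_ge0// ltW.
rewrite -subr_ge0 (_ : _ - _ = (x * y) * (v - u) + lam * (x * v - y * u)); last by ring.
exact: addr_ge0.
Qed.

Let B0_gt0 : 0 < B 0.
Proof.
have := AB 0; rewrite big_ord1 eqxx => h.
by rewrite -(pmulr_rgt0 _ (A_gt0 0)) h ltr01.
Qed.

(** If A is positive and log-convex and A B = 1, then B is nonpositive after its first
    term: eliminate B 0 between the equations of ranks n+1 and n+2; the remaining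
    coefficients are nonnegative by log-convexity and the induction applies. *)
Lemma Kaluza n : B n.+1 <= 0.
Proof.
have [N] := ubnP n; elim: N n => // N ih [|n] nN.
  have := AB 1; rewrite big_ord_recl big_ord1/= => h.
  have E : A 0 * B 1 = - (A 1 * B 0) by apply/eqP; rewrite -subr_eq0 opprK; apply/eqP.
  by rewrite -(pmulr_rle0 _ (A_gt0 0)) E oppr_le0 mulr_ge0 ?ltW.
have E1 := AB n.+2; have E2 := AB n.+1.
rewrite big_ord_recl/= in E1.
rewrite -(pmulr_rle0 _ (A_gt0 0)).
have -> : A 0 * B n.+2 = - \sum_(i < n.+2) A i.+1 * B (n.+1 - i).
  by apply/eqP; rewrite -subr_eq0 opprK; apply/eqP.
have -> : - \sum_(i < n.+2) A i.+1 * B (n.+1 - i) =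
  (\sum_(i < n.+2) (A i * A n.+2 - A i.+1 * A n.+1) * B (n.+1 - i)) / A n.+1.
  rewrite [in RHS](eq_bigr (fun i : 'I_n.+2 => A n.+2 * (A i * B (n.+1 - i)) - A n.+1 *
    (A i.+1 * B (n.+1 - i)))); last first.
    by move=> i _; rewrite mulrBl; congr (_ - _); rewrite -mulrA mulrCA.
  by rewrite sumrB -!mulr_sumr E2 /= mulr0 sub0r mulrC mulrN mulKf// gt_eqF.
rewrite big_ord_recr/= mulrC [A n.+1 * _ - _](_ : _ = 0); last by ring.
rewrite mul0r addr0 pmulr_rle0 ?invr_gt0//.
apply: sumr_le0 => i _; apply: mulr_ge0_le0.
  by rewrite subr_ge0 [leRHS]mulrC; apply: A_logconvex; rewrite ltnW// ltnS.
have [j jE] : exists j, (n.+1 - i = j.+1)%N by exists (n - i)%N; rewrite subSn// -ltnS.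
by rewrite jE; apply: ih; rewrite -ltnS -jE; apply: leq_ltn_trans nN; rewrite leq_subr.
Qed.

Lemma discrete_ml_a_sum n : discrete_ml a n = \sum_(j < n.+1) B j.
Proof.
rewrite (_ : a = (a - 1) + 1); last by ring.
rewrite -discrete_ml_conv ?subrK// (reindex_inj rev_ord_inj)/=.
by apply: eq_bigr => j _; rewrite negbin1 mul1r subSS subKn// -ltnS.
Qed.

(** In 0 = sum of A (n+1-j) B j only B 0 is positive, and A (n+1) is the least of the
    weights: replacing all of them by A (n+1) can only increase the sum. *)
Lemma discrete_ml_a_ge0 n : 0 <= discrete_ml a n.
Proof.
rewrite discrete_ml_a_sum; case: n => [|n]; first by rewrite big_ord1 ltW.
have E : \sum_(j < n.+2) A j * B (n.+1 - j) = 0 := AB n.+1.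
rewrite -(pmulr_rge0 _ (A_gt0 n.+1)) -[leLHS]E mulr_sumr.
rewrite (reindex_inj rev_ord_inj)/=; apply: ler_sum => j _.
rewrite subSS; case: j => -[|j] jn /=.
  rewrite subn0 subnn//.
have jn' : (j <= n)%N by rewrite -ltnS.
rewrite !subSS (_ : n.+1 - (n - j) = j.+1)%N; last by rewrite subSn ?leq_subr// subKn.
rewrite ler_wnM2r ?Kaluza//.
by rewrite /A lerD2r negbin_nincr// leqW// leq_subr.
Qed.

Lemma discrete_ml_a_nincr m n : (m <= n)%N -> discrete_ml a n <= discrete_ml a m.
Proof.
move=> /subnK <-; elim: (n - m)%N => [//|k ih]; apply: le_trans ih.
by rewrite addSn !discrete_ml_a_sum big_ord_recr/= gerDl Kaluza.
Qed.

(** The differences of this sequence are -lam times the values at c = a. *)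
Lemma discrete_ml_1_nincr m n : (m <= n)%N -> discrete_ml 1 n <= discrete_ml 1 m.
Proof.
move=> /subnK <-; elim: (n - m)%N => [//|k ih]; apply: le_trans ih.
have E j : discrete_ml 1 j = \sum_(i < j.+1) discrete_ml 0 i.
  rewrite -[1](add0r 1) -discrete_ml_conv ?add0r// (reindex_inj rev_ord_inj)/=.
  by apply: eq_bigr => i _; rewrite negbin1 mul1r subSS subKn// -ltnS.
rewrite addSn !E big_ord_recr/= gerDl.
have := @discrete_ml_shift 0 (k + m).+1; rewrite add0r negbin0S => /(_ c0 ca) => h.
have -> : discrete_ml 0 (k + m).+1 = - (lam * discrete_ml a (k + m).+1).
  by apply/eqP; rewrite -subr_eq0 opprK; apply/eqP.
by rewrite oppr_le0 mulr_ge0 ?discrete_ml_a_ge0 ?ltW.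
Qed.

Lemma discrete_ml_1_ge0 n : 0 <= discrete_ml 1 n.
Proof.
rewrite (_ : 1 = a + (1 - a)); last by ring.
rewrite -discrete_ml_conv//; last by rewrite (_ : a + (1 - a) = 1)//; ring.
apply: sumr_ge0 => j _; rewrite mulr_ge0 ?discrete_ml_a_ge0//.
by rewrite ltW// negbin_gt0//; have := a1; lra.
Qed.

(** In the equation of rank n, whose right-hand side is 1, bound each of the values
    of rank at most n below by the last one. *)
Lemma discrete_ml_1_le n : discrete_ml 1 n * (1 + lam * negbin (a + 1) n) <= 1.
Proof.
rewrite -[leRHS](negbin1 n) -(discrete_ml_shift n c1 cS) mulrDr mulr1 lerD2l.
rewrite mulrCA ler_pM2l// -negbin_sum mulr_sumr -discrete_ml_conv//.
apply: ler_sum => j _; rewrite mulrC ler_wpM2l ?(ltW (negbin_gt0 _ a0))//.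
by rewrite discrete_ml_1_nincr// leq_subr.
Qed.

End discrete.

(** * From the discrete to the continuous Mittag-Leffler functions *)

Section tannery.
Context {R : realType}.
Implicit Types (r C : R).

(** Only the terms after k0 are controlled by the geometric series; the first k0 terms
    are paid for by a larger constant in the proof of convergence. *)
Lemma geometric_tail (v : nat -> R) C r k0 : 0 <= C -> 0 < r -> r < 1 ->
  (forall k, (k0 <= k)%N -> `|v k| <= C * r ^+ k) ->
  cvgn (series v) /\
  (forall K, (k0 <= K)%N -> `|limn (series v) - series v K| <= C * r ^+ K / (1 - r)).
Proof.
move=> C0 r0 r1 H; have cv : cvgn (series v).
  (* large enough for the first k0 terms to obey the geometric bound as well *)
  pose C' := C + \sum_(j < k0) `|v j| / r ^+ j.
  have S0 : 0 <= \sum_(j < k0) `|v j| / r ^+ j.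
    by apply: sumr_ge0 => j _; rewrite divr_ge0 ?exprn_ge0 ?(ltW r0).
  apply: normed_cvg; apply: (@series_le_cvg _ _ (geometric C' r)).
  - by move=> k /=.
  - by move=> k; rewrite /geometric/= mulr_ge0 ?exprn_ge0 ?(ltW r0)// addr_ge0.
  - move=> k; rewrite /geometric/=; have [kk|kk] := leqP k0 k.
      by apply: (le_trans (H _ kk)); rewrite ler_pM2r ?exprn_gt0// lerDl.
    rewrite -ler_pdivrMr ?exprn_gt0// /C' (bigD1 (Ordinal kk))//=.
    rewrite addrCA lerDl addr_ge0//.
    by apply: sumr_ge0 => j _; rewrite divr_ge0 ?exprn_ge0 ?(ltW r0).
  - by apply: is_cvg_geometric_series; rewrite ger0_norm ?(ltW r0).
split => // K kK.
have T m : (K <= m)%N -> `|series v m - series v K| <= C * r ^+ K / (1 - r).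
  move=> Km; rewrite sub_series_geq//.
  apply: (@le_trans _ _ (C * ((r ^+ K - r ^+ m) / (1 - r)))); last first.
    rewrite -mulrA ler_wpM2l// ler_pM2r ?invr_gt0 ?subr_gt0//.
    by rewrite gerBl exprn_ge0// ltW.
  apply: (le_trans (ler_norm_sum _ _ _)).
  elim: m Km => [|m ih] Km.
    by move: Km; rewrite leqn0 => /eqP ->; rewrite big_geq// subrr mul0r mulr0.
  move: Km; rewrite leq_eqVlt => /predU1P[<-|Km].
    by rewrite big_geq// subrr mul0r mulr0.
  rewrite big_nat_recr//=; apply: (le_trans (lerD (ih Km) (H _ (leq_trans kK Km)))).
  rewrite le_eqVlt; apply/orP; left; apply/eqP; rewrite exprS; field.
  by rewrite subr_eq0 gt_eqF.
have L : `|series v m - series v K| @[m --> \oo] --> `|limn (series v) - series v K|.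
  by apply: cvg_norm; apply: cvgB => //; exact: cvg_cst.
rewrite -(cvg_lim (@Rhausdorff R) L); apply: limr_le; first by apply/cvg_ex; eexists; exact: L.
by near=> m; apply: T; near: m; exact: nbhs_infty_ge.
Unshelve. all: by end_near. Qed.

Lemma tannery (u : nat -> nat -> R) (v : nat -> R) C r k0 n0 : 0 <= C -> 0 < r -> r < 1 ->
  (forall n k, (n0 <= n)%N -> (k0 <= k)%N -> `|u n k| <= C * r ^+ k) ->
  (forall k, u n k @[n --> \oo] --> v k) ->
  cvgn (series v) /\ (limn (series (u n)) @[n --> \oo] --> limn (series v)).
Proof.
move=> C0 r0 r1 H uv.
have Hv k : (k0 <= k)%N -> `|v k| <= C * r ^+ k.
  move=> kk; rewrite -(cvg_lim (@Rhausdorff R) (cvg_norm (uv k))).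
  apply: limr_le; first by apply/cvg_ex; eexists; exact: (cvg_norm (uv k)).
  by near=> n; apply: H => //; near: n; exact: nbhs_infty_ge.
have [cv tv] := geometric_tail C0 r0 r1 Hv; split => //.
apply/cvgrPdist_lt => e e0.
have [K kK Ke] : exists2 K, (k0 <= K)%N & C * r ^+ K / (1 - r) < e / 3.
  have : (C * r ^+ n / (1 - r)) @[n --> \oo] --> (C * 0 / (1 - r)).
    apply: cvgM; last exact: cvg_cst.
    by apply: cvgM; [exact: cvg_cst|apply: cvg_expr; rewrite ger0_norm// ltW].
  rewrite mulr0 mul0r => /cvgrPdist_lt/(_ (e / 3)).
  have e3 : 0 < e / 3 by rewrite divr_gt0.
  move=> /(_ e3)[N _ HN]; exists (maxn k0 N); first exact: leq_maxl.
  have := HN (maxn k0 N) (leq_maxr _ _) => /=.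
  by rewrite sub0r normrN; apply: le_lt_trans; exact: ler_norm.
have : series (u n) K @[n --> \oo] --> series v K.
  by rewrite /series/=; apply: cvg_sumr.
move=> /cvgrPdist_lt/(_ (e / 3)); have e3 : 0 < e / 3 by rewrite divr_gt0.
move=> /(_ e3) h; near=> n.
have nn : (n0 <= n)%N by near: n; exact: nbhs_infty_ge.
have h1 : `|series v K - series (u n) K| < e / 3 by near: n.
have [_ /(_ K kK) h2] := geometric_tail C0 r0 r1 (H n ^~ nn).
have h3 := tv K kK.
rewrite (_ : _ - _ = (limn (series v) - series v K) + (series v K - series (u n) K)
   - (limn (series (u n)) - series (u n) K)); last by ring.
apply: (le_lt_trans (ler_normB _ _)); rewrite (_ : e = e / 3 + e / 3 + e / 3); last by field.
apply: ltrD; last exact: (le_lt_trans h2).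
by apply: (le_lt_trans (ler_normD _ _)); apply: ltrD => //; exact: (le_lt_trans h3).
Unshelve. all: by end_near. Qed.

Lemma one_add_le_powR (d x : R) : 1 <= d -> 0 <= x -> 1 + d * x <= (1 + x) `^ d.
Proof.
move=> d1 x0; have d0 : 0 < d by exact: lt_le_trans d1.
have y0 : 0 < 1 + d * x by rewrite ltr_pwDl// mulr_ge0// ltW.
have t : 0 <= d^-1 <= 1 by rewrite invr_ge0 (ltW d0) invf_le1.
have := powR_le_tangent t y0.
rewrite (_ : 1 - d^-1 + d^-1 * (1 + d * x) = 1 + x); last by field; rewrite gt_eqF.
have x1 : 0 <= 1 + x by rewrite addr_ge0.
move=> /(ge0_ler_powR (ltW d0)); rewrite !nnegrE powR_ge0 x1 => /(_ isT isT).
by rewrite -powRrM mulVf ?gt_eqF// powRr1// ltW.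
Qed.

(** Write b = 1 + d. The first I factors 1 + d / i of the product are at most b; the others
    are at most (1 + 1/i)^d by Bernoulli's inequality, and these telescope. *)
Lemma negbin_le I n (b : R) : 2 <= b -> (I <= n)%N ->
  negbin b n <= b ^+ I * (n.+1%:R / I.+1%:R) `^ (b - 1).
Proof.
move=> b2 /subnK <-; elim: (n - I)%N => [|k ih].
  rewrite add0n divff ?pnatr_eq0// powR1 mulr1.
  elim: I => [|I ih]; first by rewrite negbin0.
  rewrite negbinS exprSr; apply: ler_pM => //.
  - by rewrite ltW// negbin_gt0//; lra.
  - by rewrite divr_ge0// addr_ge0//; lra.
  - by rewrite ler_pdivrMr ?ltr0n// -natr1; have := ler0n R I; nra.
rewrite addSn negbinS.
apply: (@le_trans _ _ ((b ^+ I * ((k + I).+1%:R / I.+1%:R) `^ (b - 1)) * ((k +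
  I).+2%:R / (k + I).+1%:R) `^ (b - 1))).
  apply: ler_pM => //.
  - by rewrite ltW// negbin_gt0//; lra.
  - by rewrite divr_ge0// addr_ge0//; lra.
  have d1 : 1 <= b - 1 by lra.
  have x0 : 0 <= ((k + I).+1%:R)^-1 :> R by rewrite invr_ge0.
  have nz : (k + I).+1%:R != 0 :> R by rewrite pnatr_eq0.
  apply: (le_trans _ (le_trans (one_add_le_powR d1 x0) _)).
    rewrite le_eqVlt; apply/orP; left; apply/eqP.
    by rewrite -natr1 in nz *; field.
  rewrite (_ : 1 + _ = (k + I).+2%:R / (k + I).+1%:R)//.
  by rewrite -(natr1 (k + I).+1); field.
rewrite -mulrA -powRM ?divr_ge0//.
rewrite (_ : (k + I).+1%:R / I.+1%:R * ((k + I).+2%:R / (k + I).+1%:R) = (k +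
  I).+2%:R / I.+1%:R)//.
by rewrite mulrC mulrA divfK// pnatr_eq0.
Qed.

(** The ratio 2 T / (I + 1) is made at most exp(-2): half of the decay absorbs b^I, at the
    price of the constant I!, and the other half remains. This is the discrete trace of
    the growth of Gamma, uniform in n. *)
Lemma negbin_dominated (T : R) : 0 < T -> exists C I, 0 <= C /\
  forall n b, (I <= n)%N -> 2 <= b ->
    negbin b n.+1 * n.+1%:R `^ (1 - b) * T `^ b <= C * expR (- b).
Proof.
move=> T0; pose I := Num.truncn (2 * T * expR 2).
have I1 : 2 * T / I.+1%:R <= expR (- 2).
  rewrite expRN ler_pdivrMr ?ltr0n// [leRHS]mulrC ler_pdivlMr ?expR_gt0//.
  by apply: ltW; exact: truncnS_gt.
exists (T * I`!%:R * expR 2), I; split; first by rewrite !mulr_ge0 ?expR_ge0 ?(ltW T0).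
move=> n b In b2.
have d1 : 0 <= b - 1 by lra.
have b0 : 0 <= b by lra.
have n0 : 0 < n.+1%:R :> R by rewrite ltr0n.
have := negbin_le b2 (leqW In) => h1.
have h2 : negbin b n.+1 * n.+1%:R `^ (1 - b) <= b ^+ I * (2 / I.+1%:R) `^ (b - 1).
  rewrite -opprB powRN ler_pdivrMr ?powR_gt0//; apply: (le_trans h1).
  rewrite -mulrA ler_wpM2l ?exprn_ge0// -powRM ?divr_ge0//.
  apply: ge0_ler_powR; rewrite ?nnegrE ?mulr_ge0 ?divr_ge0//.
  rewrite mulrAC ler_pM2r ?invr_gt0//.
  rewrite -(natr1 n.+1); have h1n : 1 <= n.+1%:R :> R by rewrite ler1n.
  by lra.
have TE : T `^ b = T * T `^ (b - 1) by rewrite mulr_powRB1 ?(ltW T0)//; lra.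
apply: (@le_trans _ _ (b ^+ I * (2 / I.+1%:R) `^ (b - 1) * T `^ b)).
  by rewrite ler_wpM2r ?powR_ge0.
rewrite TE [leLHS](_ : _ = T * b ^+ I * ((2 / I.+1%:R) `^ (b - 1) * T `^ (b - 1))); last by ring.
rewrite -powRM ?divr_ge0 ?(ltW T0)//.
have h3 : (2 / I.+1%:R * T) `^ (b - 1) <= expR (- (2 * (b - 1))).
  rewrite -mulNr expRM; apply: ge0_ler_powR;
    rewrite ?nnegrE ?mulr_ge0 ?divr_ge0 ?expR_ge0 ?(ltW T0)//.
  by rewrite mulrAC.
have h4 : b ^+ I <= I`!%:R * expR b.
  have f0 : 0 < I`!%:R :> R by rewrite ltr0n fact_gt0.
  case: (I) f0 => [|m] f0.
    by rewrite expr0 fact0 mul1r; apply: le_trans (expR_ge1Dx _); rewrite lerDl.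
  by rewrite -ler_pdivrMl// mulrC; apply: le_trans (expR_ge1Dxn m b0); rewrite lerDr.
apply: (@le_trans _ _ (T * (I`!%:R * expR b) * expR (- (2 * (b - 1))))).
  apply: ler_pM => //; rewrite ?powR_ge0 ?mulr_ge0 ?exprn_ge0 ?(ltW T0)//.
  by rewrite ler_pM2l.
rewrite le_eqVlt; apply/orP; left; apply/eqP.
have -> : T * (I`!%:R * expR b) * expR (- (2 * (b - 1))) = T * I`!%:R * (expR b *
  expR (- (2 * (b - 1)))) by ring.
rewrite -[RHS]mulrA -!expRD; congr (_ * expR _); ring.
Qed.

End tannery.

Section ml_limit.
Context {R : realType}.
Variables (a : R).
Hypotheses (a0 : 0 < a).

(** With step t / (n+1), the k-th term is (-t^a)^k times the sequence of Euler's limit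
    formula at a k + c, so that Tannery's theorem applies. *)
Lemma discrete_ml_limit (c t : R) : 0 < c -> 0 < t ->
  cvgn (series (fun k => (- (t `^ a)) ^+ k / Gamma (a * k%:R + c))) /\
  (n.+1%:R `^ (1 - c) * discrete_ml a ((t / n.+1%:R) `^ a) c n.+1 @[n --> \oo] -->
    mittag_leffler a c (- (t `^ a))).
Proof.
move=> c0 t0.
pose g k : R := a * k%:R + c.
have g0 k : 0 < g k by rewrite /g ltr_wpDl// mulr_ge0// ltW.
pose u (n k : nat) : R := (- (t `^ a)) ^+ k * (negbin (g k) n.+1 * n.+1%:R `^ (1 - g k)).
have uE n k : u n k = n.+1%:R `^ (1 - c) * discrete_ml_term a ((t / n.+1%:R) `^ a) c n.+1 k.
  have n0 : 0 < n.+1%:R :> R by rewrite ltr0n.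
  rewrite /u /discrete_ml_term -/(g k) -[- (t `^ a)]mulN1r -[- ((t / _) `^ a)]mulN1r !exprMn.
  rewrite powRM ?invr_ge0 ?(ltW t0)// exprMn -powR_inv1// powRAC powR_inv1 ?powR_ge0//.
  have -> : n.+1%:R `^ (1 - g k) = n.+1%:R `^ (1 - c) * ((n.+1%:R `^ a)^-1) ^+ k.
    rewrite exprVn -powR_mulrn ?powR_ge0// -powRrM -powRN -powRD ?(gt_eqF n0) ?implybT//.
    by congr (_ `^ _); rewrite /g; ring.
  by ring.
have [k0 hk0] : exists k0 : nat, forall k, (k0 <= k)%N -> 2 <= g k.
  exists (Num.truncn (2 / a)).+1 => k kk; rewrite /g.
  have := truncnS_gt (2 / a); rewrite ltr_pdivrMr// => h.
  have : (Num.truncn (2 / a)).+1%:R * a <= a * k%:R by rewrite mulrC ler_pM2l// ler_nat.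
  lra.
have [C [I [C0 H]]] := negbin_dominated t0.
have tc : 0 < t `^ c by rewrite powR_gt0.
have b n k : (I <= n)%N -> (k0 <= k)%N -> `|u n k| <= (C * expR (- c) / t `^ c) * expR (- a) ^+ k.
  move=> In kk; have := H n (g k) In (hk0 _ kk).
  have nb : 0 < negbin (g k) n.+1 by apply: negbin_gt0.
  rewrite normrM normrX normrN (ger0_norm (powR_ge0 _ _)) ger0_norm; last first.
    by rewrite mulr_ge0 ?powR_ge0 ?(ltW nb).
  have -> : t `^ g k = (t `^ a) ^+ k * t `^ c.
    by rewrite powRD ?(gt_eqF t0) ?implybT// powRrM powR_mulrn ?powR_ge0.
  have -> : expR (- g k) = expR (- a) ^+ k * expR (- c).
    by rewrite -expRM_natr -expRD; congr expR; rewrite /g; ring.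
  move=> h.
  rewrite [leRHS](_ : _ = (C * (expR (- a) ^+ k * expR (- c))) / t `^ c); last by ring.
  by rewrite ler_pdivlMr//; apply: le_trans h; rewrite le_eqVlt; apply/orP; left; apply/eqP; ring.
have uv k : u n k @[n --> \oo] --> (- (t `^ a)) ^+ k / Gamma (a * k%:R + c).
  by apply: cvgM; [exact: cvg_cst|exact: negbin_cvg].
have [] := @tannery R u _ _ (expR (- a)) k0 I _ _ _ b uv.
- by rewrite divr_ge0 ?mulr_ge0 ?expR_ge0 ?(ltW tc).
- exact: expR_gt0.
- by rewrite expR_lt1 oppr_lt0.
move=> cv L; split => //.
apply: cvg_trans L; apply: near_eq_cvg; near=> n.
have E : series (u n) = (fun m => n.+1%:R `^ (1 - c) *
  series (discrete_ml_term a ((t / n.+1%:R) `^ a) c n.+1) m).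
  by apply/funext => m; rewrite /series/= mulr_sumr; apply: eq_bigr => k _; rewrite uE.
have nn : (I <= n)%N by near: n; exact: nbhs_infty_ge.
have [|||cvu _] := @geometric_tail R (u n) _ (expR (- a)) k0 _ _ _ (b n ^~ nn).
- by rewrite divr_ge0 ?mulr_ge0 ?expR_ge0 ?(ltW tc).
- exact: expR_gt0.
- by rewrite expR_lt1 oppr_lt0.
have q0 : 0 < n.+1%:R `^ (1 - c) by rewrite powR_gt0.
rewrite /discrete_ml; set S := series (discrete_ml_term _ _ _ _).
have -> : S = (fun m => (n.+1%:R `^ (1 - c))^-1 * series (u n) m).
  by apply/funext => m; rewrite E mulKf// gt_eqF.
rewrite (cvg_lim (@Rhausdorff R) (cvgM (cvg_cst _) cvu)).
by rewrite mulVKf// gt_eqF.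
Unshelve. all: by end_near. Qed.
End ml_limit.

(** * The relaxation function and its kernel *)

Section entire.
Context {R : realType}.

(** The factor k + 1 is absorbed by doubling the radius. *)
Lemma entire_diffs (c : nat -> R) : (forall x : R, cvgn (pseries c x)) ->
  forall x : R, cvgn (pseries (pseries_diffs c) x).
Proof.
move=> H x; pose X := `|x| + 1.
have X0 : 0 < X by rewrite ltr_wpDl.
have xX : `|x| < X by rewrite ltrDl.
have HX : cvgn (pseries (fun k => `|c k|) (2 * X)).
  apply: (@is_cvg_pseries_inside_norm _ _ (3 * X)) => //.
  by rewrite !gtr0_norm ?mulr_gt0// ltr_pM2r// ltr_nat.
apply: (@is_cvg_pseries_inside _ _ X); last by rewrite (gtr0_norm X0).
apply: normed_cvg.
have HS : cvgn (series (fun k => X^-1 * (`|c k.+1| * (2 * X) ^+ k.+1))).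
  rewrite (_ : series _ = (fun m => X^-1 * (pseries (fun k => `|c k|) (2 * X) m.+1 - `|c 0%N|))).
    apply: is_cvgMr; apply: is_cvgB; last exact: is_cvg_cst.
    by apply/(cvg_ex); move/cvg_ex: HX => [l Hl]; exists l;
      rewrite (cvg_shiftS (pseries (fun k => `|c k|) (2 * X))).
  apply/funext => m; rewrite /pseries /series/= big_nat_recl// expr0 mulr1.
  by rewrite [X in _ = _ * X]addrC addKr mulr_sumr.
apply: series_le_cvg HS => [k|k|k] /=.
- by [].
- by rewrite !mulr_ge0 ?invr_ge0 ?exprn_ge0 ?mulr_ge0 ?(ltW X0).
rewrite /pseries_diffs !normrM normr_nat normrX (gtr0_norm X0).
have k2 : k.+1%:R <= 2 ^+ k.+1 :> R by rewrite -natrX ler_nat ltnW// ltn_expl.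
rewrite [leRHS](_ : _ = 2 ^+ k.+1 * (`|c k.+1| * X ^+ k)); last first.
  by rewrite exprMn [X ^+ k.+1]exprS; field; rewrite gt_eqF.
by rewrite -mulrA ler_wpM2r// mulr_ge0// exprn_ge0// ltW.
Qed.

Lemma entire_is_derive (c : nat -> R) : (forall x : R, cvgn (pseries c x)) ->
  forall x : R, is_derive x 1 (fun x => limn (pseries c x)) (limn (pseries (pseries_diffs c) x)).
Proof.
move=> H x; have H1 := entire_diffs H; have H2 := entire_diffs H1.
apply: (@pseries_snd_diffs _ _ (`|x| + 1)) => //.
by rewrite [ltRHS]ger0_norm ?addr_ge0// ltrDl.
Qed.

End entire.

Section ml.
Context {R : realType}.
Variables (a : R).
Hypotheses (a0 : 0 < a) (a1 : a < 1).

Let coef c k : R := (Gamma (a * k%:R + c))^-1.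

Lemma mlE c z : mittag_leffler a c z = limn (pseries (coef c) z).
Proof.
by rewrite /mittag_leffler /pseries; congr (limn (series _)); apply/funext => k; rewrite mulrC.
Qed.

Let coef_entire c : 0 < c -> forall z : R, cvgn (pseries (coef c) z).
Proof.
move=> c0 z; pose t : R := (`|z| + 1) `^ a^-1.
have z0 : 0 < `|z| + 1 by rewrite ltr_wpDl.
have t0 : 0 < t by rewrite powR_gt0.
have [cv _] := discrete_ml_limit a0 c0 t0.
apply: (@is_cvg_pseries_inside _ _ (- (t `^ a))).
  rewrite (_ : pseries _ _ = series (fun k => (- (t `^ a)) ^+ k / Gamma (a * k%:R + c)))//.
  by congr series; apply/funext => k; rewrite mulrC.
by rewrite [ltRHS]normrN [ltRHS]ger0_norm ?powR_ge0// -powRrM mulVf ?gt_eqF//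
  powRr1 ?(ltW z0)// ltrDl.
Qed.

Lemma is_derive_ml (z : R) : is_derive z 1 (mittag_leffler a 1) (a^-1 * mittag_leffler a a z).
Proof.
have := entire_is_derive (coef_entire ltr01) z.
have -> : (fun x => limn (pseries (coef 1) x)) = mittag_leffler a 1.
  by apply/funext => x; rewrite mlE.
congr (is_derive _ _ _ _); rewrite mlE.
have cv := @coef_entire a a0 z.
rewrite -(cvg_lim (@Rhausdorff R) (cvgM (cvg_cst a^-1) cv)).
congr (lim (_ @ \oo)); apply/funext => m; rewrite /pseries /series/= mulr_sumr.
apply: eq_bigr => k _; rewrite /pseries_diffs /coef.
have h : 0 < a * k%:R + a by rewrite ltr_wpDl// mulr_ge0// ltW.
rewrite (_ : a * k.+1%:R + 1 = a * k%:R + a + 1); last by rewrite -natr1; ring.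
rewrite (Gamma_addr1 h) invfM !mulrA; move: (Gamma _)^-1 => G.
rewrite -natr1; have k1 : k%:R + 1 != 0 :> R by rewrite natr1 pnatr_eq0.
by field; rewrite (lt0r_neq0 a0) (lt0r_neq0 h).
Qed.

Lemma continuous_ml c : 0 < c -> continuous (mittag_leffler a c).
Proof.
move=> c0 z; apply: differentiable_continuous; apply/derivable1_diffP.
have -> : mittag_leffler a c = (fun x => limn (pseries (coef c) x)).
  by apply/funext => x; rewrite mlE.
by have [] := entire_is_derive (coef_entire c0) z.
Qed.

Lemma ml_at0 : mittag_leffler a 1 (0 : R) = 1.
Proof.
apply/cvg_lim => //; apply: cvg_near_cst; near=> n.
have [m ->] : exists m, n = m.+1.
  exists n.-1; rewrite prednK//; near: n; exact: nbhs_infty_gt.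
rewrite /series/= big_nat_recl// big1; last by move=> k _; rewrite expr0n mul0r.
by rewrite expr0 mulr0 add0r Gamma1 divr1 addr0.
Unshelve. all: by end_near. Qed.

Lemma f_at0 : f_ a (0 : R) = 1.
Proof. by rewrite /f_ powR0 ?gt_eqF// oppr0 ml_at0. Qed.

Lemma is_derive_f (t : R) : 0 < t -> is_derive t 1 (f_ a) (- g_ a t).
Proof.
move=> t0; have d1 : is_derive t 1 (fun s : R => - (s `^ a)) (- (a * t `^ (a - 1))).
  by have d0 := is_derive1_powR a t0; exact: is_deriveN.
have d2 := is_derive_ml (- (t `^ a)).
have := @is_derive1_comp R (mittag_leffler a 1) (fun s : R => - (s `^ a)) t _ _ d2 d1.
rewrite (_ : _ * _ = - g_ a t)//; rewrite /g_; field; exact: lt0r_neq0.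
Qed.

Lemma continuous_f (t : R) : 0 < t -> {for t, continuous (f_ a)}.
Proof.
move=> t0; apply: differentiable_continuous; apply/derivable1_diffP.
by have [] := is_derive_f t0.
Qed.

Lemma continuous_g (t : R) : 0 < t -> {for t, continuous (g_ a)}.
Proof.
move=> t0; apply: cvgM; first exact: continuous_powR.
apply: (@continuous_comp _ _ _ (fun s : R => - (s `^ a)) (mittag_leffler a a)).
  by apply: cvgN; exact: continuous_powR.
exact: continuous_ml.
Qed.

Lemma f_cvg0 : f_ a t @[t --> 0^'+] --> (1 : R).
Proof.
rewrite -ml_at0; apply: (@cvg_comp _ _ _ (fun s : R => - (s `^ a))
  (mittag_leffler a 1) _ (nbhs (0 : R))).
  by rewrite -[X in _ `=>` nbhs X]oppr0; apply: cvgN; exact: powR_cvg0.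
exact: (@continuous_ml 1 ltr01 0).
Qed.

Let step_powR_lt1 (t : R) : 0 < t -> \forall n \near \oo, 0 < (t / n.+1%:R) `^ a < 1.
Proof.
move=> t0; near=> n.
have tn : t < n.+1%:R.
  apply: (lt_le_trans (truncnS_gt t)); rewrite ler_nat ltnS.
  by near: n; exact: nbhs_infty_ge.
rewrite powR_gt0 ?divr_gt0//=.
rewrite -[ltRHS](_ : 1 `^ a = 1); last by rewrite powR1.
apply: gt0_ltr_powR; rewrite ?nnegrE ?divr_ge0 ?(ltW t0)//.
by rewrite ltr_pdivrMr ?mul1r.
Unshelve. all: by end_near. Qed.

Let f_lim (t : R) : 0 < t -> discrete_ml a ((t / n.+1%:R) `^ a) 1 n.+1 @[n --> \oo] --> f_ a t.
Proof.
move=> t0; have [_] := discrete_ml_limit a0 ltr01 t0; apply: cvg_trans.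
by apply: near_eq_cvg; near=> n; rewrite subrr powRr0 mul1r.
Unshelve. all: by end_near. Qed.

Lemma f_ge0 (t : R) : 0 <= t -> 0 <= f_ a t.
Proof.
rewrite le_eqVlt => /predU1P[<-|t0]; first by rewrite f_at0.
have L := f_lim t0; rewrite -(cvg_lim (@Rhausdorff R) L).
apply: limr_ge; first by apply/cvg_ex; eexists; exact: L.
near=> n; have /andP[l0 l1] : 0 < (t / n.+1%:R) `^ a < 1 by near: n; exact: step_powR_lt1.
exact: discrete_ml_1_ge0.
Unshelve. all: by end_near. Qed.

(** The limit of [discrete_ml_1_le]; hence f_ a t = O(t^(-a)). *)
Lemma f_bound (t : R) : 0 < t -> f_ a t * (1 + t `^ a / Gamma (a + 1)) <= 1.
Proof.
move=> t0; have L0 := f_lim t0.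
have a1' : 0 < a + 1 by rewrite addr_gt0.
have L : (discrete_ml a ((t / n.+1%:R) `^ a) 1 n.+1 * (1 + t `^ a * (negbin (a + 1) n.+1 *
  n.+1%:R `^ (1 - (a + 1))))) @[n --> \oo] --> f_ a t * (1 + t `^ a / Gamma (a + 1)).
  apply: cvgM => //; apply: cvgD; first exact: cvg_cst.
  by apply: cvgM; [exact: cvg_cst|exact: negbin_cvg].
rewrite -(cvg_lim (@Rhausdorff R) L).
apply: limr_le; first by apply/cvg_ex; eexists; exact: L.
near=> n; have /andP[l0 l1] : 0 < (t / n.+1%:R) `^ a < 1 by near: n; exact: step_powR_lt1.
apply: le_trans (discrete_ml_1_le a0 a1 l0 l1 n.+1).
rewrite le_eqVlt; apply/orP; left; apply/eqP; congr (_ * (1 + _)).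
rewrite powRM ?invr_ge0 ?(ltW t0)// -powR_inv1// powRAC powR_inv1 ?powR_ge0// -powRN.
by rewrite opprD addrCA subrr addr0; ring.
Unshelve. all: by end_near. Qed.

Lemma f_pinfty : f_ a t @[t --> +oo] --> (0 : R).
Proof.
have G0 : 0 < Gamma (a + 1) by apply: Gamma_gt0; rewrite addr_gt0.
apply/cvgrPdist_lt => e e0; near=> t.
have t0 : 0 < t by near: t; apply: nbhs_pinfty_gt; exact: num_real.
have tb : Gamma (a + 1) / e < t `^ a.
  by near: t; move: (powR_pinfty a0) => /cvgryPgt; exact.
rewrite sub0r normrN ger0_norm ?f_ge0 ?(ltW t0)//.
have := f_bound t0; have := f_ge0 (ltW t0); set x := f_ a t => x0 h.
move: tb; rewrite ltr_pdivrMr// => tb.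
have h2 : x * (t `^ a / Gamma (a + 1)) <= 1.
  by apply: le_trans h; rewrite mulrDr mulr1 lerDr.
rewrite ltNge; apply/negP => ex; move: h2; rewrite leNgt => /negP; apply.
rewrite mulrA ltr_pdivlMr// mul1r; apply: (lt_le_trans tb).
by rewrite [leRHS]mulrC ler_wpM2l ?powR_ge0.
Unshelve. all: by end_near. Qed.

Let g_lim (t : R) : 0 < t ->
  t `^ (a - 1) * (n.+1%:R `^ (1 - a) *
    discrete_ml a ((t / n.+1%:R) `^ a) a n.+1) @[n --> \oo] --> g_ a t.
Proof. by move=> t0; apply: cvgM; [exact: cvg_cst|exact: (discrete_ml_limit a0 a0 t0).2]. Qed.

Lemma g_ge0 (t : R) : 0 < t -> 0 <= g_ a t.
Proof.
move=> t0; have L := g_lim t0; rewrite -(cvg_lim (@Rhausdorff R) L).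
apply: limr_ge; first by apply/cvg_ex; eexists; exact: L.
near=> n; have /andP[l0 l1] : 0 < (t / n.+1%:R) `^ a < 1 by near: n; exact: step_powR_lt1.
by rewrite !mulr_ge0 ?powR_ge0// discrete_ml_a_ge0.
Unshelve. all: by end_near. Qed.

(** With the same step s / (n+1), the points p s for different integers p are read on one
    sequence, at the ranks p (n+1). *)
Let g_lim_sub (s : R) (p : nat) : 0 < s -> (0 < p)%N ->
  (s / n.+1%:R) `^ (a - 1) * discrete_ml a ((s / n.+1%:R) `^ a) a (p *
    n.+1) @[n --> \oo] --> g_ a (p%:R * s).
Proof.
move=> s0 p0; have pp : 0 < p%:R :> R by rewrite ltr0n.
have ps0 : 0 < p%:R * s by rewrite mulr_gt0.
have := @cvg_comp _ _ _ (fun n : nat => (p * n.+1).-1) _ \oo \oo _ _ (g_lim ps0).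
have h : (fun n : nat => (p * n.+1).-1) @ \oo --> \oo.
  move=> P [N _ HN]; exists N => // n /= Nn; apply: HN => /=.
  rewrite -ltnS prednK ?muln_gt0 ?p0//.
  by apply: leq_trans (leq_pmull _ p0); rewrite ltnS.
move=> /(_ h); apply: cvg_trans; apply: near_eq_cvg; near=> n => /=.
have n0 : 0 < n.+1%:R :> R by rewrite ltr0n.
rewrite prednK ?muln_gt0 ?p0// natrM.
have E : p%:R * s / (p%:R * n.+1%:R) = s / n.+1%:R.
  by rewrite invfM mulrACA divff ?mul1r// gt_eqF.
have E2 : (s / n.+1%:R) `^ (a - 1) = (p%:R * s) `^ (a - 1) * (p%:R * n.+1%:R) `^ (1 - a).
  rewrite -E powRM ?mulr_ge0 ?invr_ge0 ?mulr_ge0 ?(ltW s0)//; congr (_ * _).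
  rewrite -[(p%:R * n.+1%:R)^-1]powR_inv1 ?mulr_ge0// -powRrM; congr (_ `^ _); ring.
by rewrite E E2 mulrA.
Unshelve. all: by end_near. Qed.

Let g_nincr_nat (s : R) (p q : nat) : 0 < s -> (0 < p)%N -> (p <= q)%N ->
  g_ a (q%:R * s) <= g_ a (p%:R * s).
Proof.
move=> s0 p0 pq.
have Lp := g_lim_sub s0 p0; have Lq := g_lim_sub s0 (leq_trans p0 pq).
rewrite -(cvg_lim (@Rhausdorff R) Lp) -(cvg_lim (@Rhausdorff R) Lq).
apply: ler_lim.
- by apply/cvg_ex; eexists; exact: Lq.
- by apply/cvg_ex; eexists; exact: Lp.
near=> n; have /andP[l0 l1] : 0 < (s / n.+1%:R) `^ a < 1 by near: n; exact: step_powR_lt1.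
rewrite ler_wpM2l ?powR_ge0//; apply: discrete_ml_a_nincr => //.
by rewrite leq_mul2r pq orbT.
Unshelve. all: by end_near. Qed.

(** The discrete comparison gives it for commensurable s and t; approximate t from
    above by multiples of s / (n+1) and use continuity. *)
Lemma g_nincr (s t : R) : 0 < s -> s <= t -> g_ a t <= g_ a s.
Proof.
move=> s0 st; have t0 : 0 < t by exact: lt_le_trans st.
pose q n := (Num.truncn (n.+1%:R * t / s)).+1.
pose tt n : R := (q n)%:R * (s / n.+1%:R).
have qb n : n.+1%:R * t / s < (q n)%:R <= n.+1%:R * t / s + 1.
  have h : 0 <= n.+1%:R * t / s by rewrite divr_ge0 ?mulr_ge0 ?(ltW t0) ?(ltW s0).
  by rewrite truncnS_gt/= /q -natr1 lerD2r truncn_le.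
have tb n : t <= tt n <= t + s / n.+1%:R.
  have n0 : 0 < n.+1%:R :> R by rewrite ltr0n.
  have sn : 0 < s / n.+1%:R by rewrite divr_gt0.
  have /andP[h1 h2] := qb n.
  have e : n.+1%:R * t / s * (s / n.+1%:R) = t by field; rewrite nat1r pnatr_eq0/= gt_eqF.
  apply/andP; split; first by rewrite -[leLHS]e ler_pM2r// ltW.
  by rewrite -[X in X + _]e -[X in _ + X]mul1r -mulrDl ler_pM2r.
have L : tt n @[n --> \oo] --> t.
  apply: (squeeze_cvgr (f := fun=> t) (h := fun n => t + s / n.+1%:R)).
  - by near=> n; exact: tb.
  - exact: cvg_cst.
  - rewrite -[X in _ --> X]addr0 -[X in _ --> _ + X](mulr0 s).
    by apply: cvgD; [exact: cvg_cst|apply: cvgM; [exact: cvg_cst|exact: cvg_harmonic]].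
have Lg : g_ a (tt n) @[n --> \oo] --> g_ a t.
  by apply: (@cvg_comp _ _ _ tt (g_ a) _ (nbhs t)) => //; exact: (continuous_g t0).
rewrite -(cvg_lim (@Rhausdorff R) Lg); apply: limr_le; first by apply/cvg_ex; eexists; exact: Lg.
near=> n; have n0 : n.+1%:R != 0 :> R by rewrite pnatr_eq0.
have sn : 0 < s / n.+1%:R by rewrite divr_gt0.
have -> : s = n.+1%:R * (s / n.+1%:R) by rewrite mulrCA divff ?mulr1.
rewrite /tt; apply: g_nincr_nat => //.
rewrite -(ler_nat R); have /andP[+ _] := qb n; move=> /ltW; apply: le_trans.
by rewrite ler_pdivlMr// ler_pM2l// ltr0n.
Unshelve. all: by end_near. Qed.

Lemma g_integrable : (@lebesgue_measure R).-integrable `](0:R), +oo[ (EFin \o g_ a).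
Proof.
apply: (@ge0_FTC0y_integrable R (g_ a) (fun t => - f_ a t) (-1) (-0)).
- exact: continuous_g.
- exact: g_ge0.
- by move=> t t0; have d := is_derive_f t0; apply: is_derive_eq; rewrite opprK.
- by apply: cvgN; exact: f_cvg0.
- by apply: cvgN; exact: f_pinfty.
Qed.

Lemma g_integral0y : \int[@lebesgue_measure R]_(x in `]0, +oo[) g_ a x = 1.
Proof.
rewrite /Rintegral; transitivity (fine (-0 - (-1) : R)%:E); last by rewrite /= oppr0 opprK add0r.
congr fine; apply: (@ge0_FTC0y R (g_ a) (fun t => - f_ a t)).
- exact: continuous_g.
- exact: g_ge0.
- by move=> t t0; have d := is_derive_f t0; apply: is_derive_eq; rewrite opprK.
- by apply: cvgN; exact: f_cvg0.
- by apply: cvgN; exact: f_pinfty.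
Qed.

Lemma g_integralty (t : R) : 0 < t -> \int[@lebesgue_measure R]_(x in `[t, +oo[) g_ a x = f_ a t.
Proof.
move=> t0; rewrite (@Rintegral_ge0_continuous_FTC2y R (g_ a) (fun t => - f_ a t) t (-0)).
- by rewrite oppr0 opprK add0r.
- by move=> x tx; apply: g_ge0; exact: lt_le_trans tx.
- apply: continuous_in_subspaceT => x; rewrite inE/= in_itv/= andbT => tx.
  by apply: continuous_g; exact: lt_le_trans tx.
- by apply: cvgN; exact: f_pinfty.
- by move=> x tx; have [] := is_deriveN (is_derive_f (lt_trans t0 tx)).
- by apply: cvg_at_right_filter; apply: cvgN; exact: continuous_f.
- move=> x; rewrite in_itv/= andbT => /(lt_trans t0) x0.
  by rewrite derive1E; have d := is_derive_f x0; rewrite derive_val opprK.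
Qed.

End ml.

(** * Means over the elapsed time *)

Section reflection.
Context {R : realType}.
Local Notation mu := (@lebesgue_measure R).

(** Declared as a measurable map so that the image of the Lebesgue measure is a measure. *)
Definition reflect (t : R) (s : measurableTypeR R) : measurableTypeR R := t - s.

Lemma measurable_reflect (t : R) : measurable_fun setT (reflect t).
Proof.
apply: continuous_measurable_fun => s; apply: cvgB; [exact: cvg_cst|exact: cvg_id].
Qed.

HB.instance Definition _ (t : R) :=
  isMeasurableFun.Build _ _ _ _ (reflect t) (measurable_reflect t).

Lemma lebesgue_measure_reflect (t : R) (A : set R) : measurable A ->
  pushforward mu (reflect t) A = mu A.
Proof.
move=> mA; apply/esym/lebesgue_measure_unique => //= _ [[a b]] _ <-.
rewrite /pushforward.
have -> : reflect t @^-1` `]a, b]%classic = `[t - b, t - a[%classic.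
  by apply/seteqP; split => s /=; rewrite /reflect !in_itv/= => /andP[h1 h2]; apply/andP;
    split; lra.
rewrite !lebesgue_measure_itv/= !lte_fin.
rewrite ltrD2l ltrN2 -!EFinB; case: ifP => // _; congr EFin; ring.
Qed.

Lemma integrable_reflect (F : R -> R) (t : R) :
  mu.-integrable setT (EFin \o F) ->
  mu.-integrable setT (EFin \o (fun s => F (t - s))).
Proof.
move=> /integrableP[mF iF]; apply/integrableP; split.
  exact: (measurableT_comp mF (measurable_reflect t)).
apply: le_lt_trans iF; rewrite le_eqVlt; apply/orP; left; apply/eqP.
have := @ge0_integral_pushforward _ _ _ _ R (reflect t)
  (measurable_reflect t) mu setT (fun s => `|(F s)%:E|)%E measurableT.
rewrite preimage_setT => <-.
- by apply: eq_measure_integral => //= A mA _; exact: lebesgue_measure_reflect.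
- by apply: measurableT_comp.
- by move=> y _.
Qed.

Lemma Rintegral_reflect (F : R -> R) (t : R) :
  mu.-integrable setT (EFin \o F) ->
  \int[mu]_s F (t - s) = \int[mu]_s F s.
Proof.
move=> iF; have mF := measurable_int _ iF; congr fine.
have := @integral_pushforward _ _ _ _ R (reflect t) (measurable_reflect t) mu setT (fun s =>
  (F s)%:E) mF.
rewrite preimage_setT => /(_ (integrable_reflect t iF) measurableT) <-.
by apply: eq_measure_integral => //= A mA _; exact: lebesgue_measure_reflect.
Qed.

Lemma Rintegral_shift (F : R -> R) (h : R) :
  mu.-integrable setT (EFin \o F) ->
  mu.-integrable setT (EFin \o (fun s => F (s + h))) /\
  \int[mu]_s F (s + h) = \int[mu]_s F s.
Proof.
move=> iF; have i1 := integrable_reflect h iF.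
have E : (fun s => F (s + h)) = (fun s => (fun u => F (h - u)) (0 - s)).
  by apply/funext => s /=; congr F; ring.
rewrite E; split; first exact: integrable_reflect i1.
by rewrite (Rintegral_reflect 0 i1) Rintegral_reflect.
Qed.

End reflection.

(** What the study of fronts retains of the kernel g_ a and of its tail mass f_ a. *)
Record memory_kernel {R : realType} (g f : R -> R) : Prop := {
  mk_ge0 : forall r, 0 < r -> 0 <= g r;
  mk_nincr : forall r s, 0 < r -> r <= s -> g s <= g r;
  mk_int : (@lebesgue_measure R).-integrable `](0:R), +oo[ (EFin \o g);
  mk_one : \int[@lebesgue_measure R]_(r in `]0, +oo[) g r = 1;
  mk_tail : forall t, 0 < t -> \int[@lebesgue_measure R]_(r in `[t, +oo[) g r = f t;
  mk_f0 : f 0 = 1;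
  mk_lt1 : forall t, 0 < t -> f t < 1;
  mk_cvg0 : f t @[t --> 0^'+] --> (1 : R);
  mk_pinfty : f t @[t --> +oo] --> (0 : R) }.

Section average.
Context {R : realType}.
Local Notation mu := (@lebesgue_measure R).
Variables (g f : R -> R).
Hypothesis (gf : memory_kernel g f).
Implicit Types (phi psi : R -> R).

(** Extended by zero, the kernel can be translated along the whole line. *)
Definition g0 r : R := if 0 < r then g r else 0.
Definition avg phi : R := \int[mu]_r (g0 r * phi r).
(** The test functions that are integrable against the kernel. *)
Definition bmeas phi := measurable_fun setT phi /\ exists B, forall r, `|phi r| <= B.

Lemma bmeas_cst c : bmeas (fun=> c).
Proof. by split => //; exists `|c|. Qed.

Lemma bmeasD phi psi : bmeas phi -> bmeas psi -> bmeas (fun r => phi r + psi r).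
Proof.
move=> [m1 [B1 b1]] [m2 [B2 b2]]; split; first exact: measurable_funD.
by exists (B1 + B2) => r; rewrite (le_trans (ler_normD _ _))// lerD.
Qed.

Lemma bmeasM phi psi : bmeas phi -> bmeas psi -> bmeas (fun r => phi r * psi r).
Proof.
move=> [m1 [B1 b1]] [m2 [B2 b2]]; split; first exact: measurable_funM.
by exists (B1 * B2) => r; rewrite normrM ler_pM.
Qed.

Lemma bmeas_if (b : R -> bool) phi psi : measurable_fun setT b -> bmeas phi -> bmeas psi ->
  bmeas (fun r => if b r then phi r else psi r).
Proof.
move=> mb [m1 [B1 b1]] [m2 [B2 b2]]; split; first exact: measurable_fun_ifT.
exists (Num.max B1 B2) => r; case: ifP => _; rewrite le_max.
  by rewrite b1.
by rewrite b2 orbT.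
Qed.

Lemma bmeas_ind (b : R -> bool) : measurable_fun setT b -> bmeas (fun r => (b r)%:R).
Proof.
move=> mb; have := bmeas_if mb (bmeas_cst 1) (bmeas_cst 0).
by congr bmeas; apply/funext => r; case: (b r).
Qed.

Lemma measurable_ler_cst (t : R) : measurable_fun setT (fun r : R => r <= t).
Proof. exact: measurable_fun_ler. Qed.

Lemma measurable_itv_cst (p q : R) : measurable_fun setT (fun r : R => p <= r <= q).
Proof. by apply: measurable_and; exact: measurable_fun_ler. Qed.

Lemma g0_ge0 r : 0 <= g0 r.
Proof. by rewrite /g0; case: ifP => // r0; exact: (mk_ge0 gf). Qed.

Lemma g0_nincr r s : 0 < r -> r <= s -> g0 s <= g0 r.
Proof. by move=> r0 rs; rewrite /g0 r0 (lt_le_trans r0 rs); exact: (mk_nincr gf). Qed.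

Lemma g0E : g0 = g \_ `]0, +oo[.
Proof. by apply/funext => r; rewrite /g0 patchE mem_setE in_itv/= andbT. Qed.

Lemma g0_integrable : mu.-integrable setT (EFin \o g0).
Proof.
have := mk_int gf; rewrite integrable_mkcond//; apply: eq_integrable => // r _ /=.
by rewrite g0E !patchE; case: ifP.
Qed.

Lemma avg_integrable phi : bmeas phi -> mu.-integrable setT (EFin \o (fun r => g0 r * phi r)).
Proof.
move=> [mphi [B bB]]; have i := integrable_mulrl B measurableT g0_integrable.
apply: le_integrable i => //.
  apply/measurable_EFinP; apply: measurable_funM => //.
  by apply/measurable_EFinP; exact: measurable_int g0_integrable.
move=> r _; rewrite /= lee_fin !normrM mulrC ler_wpM2r//.
by rewrite (le_trans (bB r))// ler_norm.
Qed.

Lemma avg_le phi psi : bmeas phi -> bmeas psi ->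
  (forall r, 0 < r -> phi r <= psi r) -> avg phi <= avg psi.
Proof.
move=> b1 b2 H; apply: le_Rintegral => //; [exact: avg_integrable|exact: avg_integrable|].
move=> r _; rewrite /g0; case: ifP => r0; last by rewrite !mul0r.
by rewrite ler_wpM2l ?H//; exact: (mk_ge0 gf).
Qed.

(** Two balances at different times are compared by aligning the instants they
    look back to; r and r + h are the two elapsed times to the same instant. *)
Lemma avg_le_shift h phi psi : bmeas phi -> bmeas psi ->
  (forall r, g0 r * phi r <= g0 (r + h) * psi (r + h)) -> avg phi <= avg psi.
Proof.
move=> b1 b2 H; have [i E] := Rintegral_shift h (avg_integrable b2).
rewrite /avg -E; apply: le_Rintegral => //; exact: avg_integrable.
Qed.

Lemma avgD phi psi : bmeas phi -> bmeas psi ->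
  avg (fun r => phi r + psi r) = avg phi + avg psi.
Proof.
move=> b1 b2; rewrite /avg -RintegralD//; [|exact: avg_integrable..].
by congr Rintegral; apply/funext => r; rewrite mulrDr.
Qed.

Lemma avgZ c phi : bmeas phi -> avg (fun r => c * phi r) = c * avg phi.
Proof.
move=> b1; rewrite /avg -RintegralZl//; last exact: avg_integrable.
by congr Rintegral; apply/funext => r; rewrite mulrCA.
Qed.

Lemma avg_cst c : avg (fun=> c) = c.
Proof.
have -> : (fun=> c) = (fun r : R => c * (fun=> 1) r) by apply/funext => r; rewrite mulr1.
rewrite avgZ; last exact: bmeas_cst.
rewrite /avg -[RHS]mulr1; congr (_ * _); rewrite -[RHS](mk_one gf) [in RHS]Rintegral_mkcond.
by congr Rintegral; apply/funext => r; rewrite mulr1 g0E.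
Qed.

Lemma avg_ler t : 0 <= t -> avg (fun r => (r <= t)%R%:R) = 1 - f t.
Proof.
rewrite le_eqVlt => /predU1P[<-|t0].
  rewrite (mk_f0 gf) subrr -[RHS](avg_cst 0) /avg.
  congr Rintegral; apply/funext => r; rewrite /g0; case: ifP => r0; last by rewrite !mul0r.
  by rewrite leNgt r0.
have bi := bmeas_ind (measurable_ler_cst t).
have E : avg (fun r => (r <= t)%R%:R + (1 + (-1) * (r <= t)%R%:R)) = 1.
  by rewrite -[RHS](avg_cst 1); congr avg; apply/funext => r; ring.
rewrite avgD// in E; last by apply: bmeasD; [exact: bmeas_cst|apply: bmeasM => //;
  exact: bmeas_cst].
suff T : avg (fun r => 1 + (-1) * (r <= t)%R%:R) = f t by apply/eqP;
  rewrite eq_sym subr_eq -{1}E T.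
rewrite -(mk_tail gf t0) -Rintegral_itv_obnd_cbnd.
  rewrite Rintegral_mkcond /avg; congr Rintegral; apply/funext => r.
  rewrite patchE mem_setE in_itv/= andbT /g0.
  have [rt|tr] := leP r t; first by rewrite mulN1r subrr mulr0.
  by rewrite (lt_trans t0 tr) mulr0 addr0 mulr1.
apply: integrableS (mk_int gf) => //.
by move=> r /=; rewrite !in_itv/= !andbT; exact: lt_trans.
Qed.

Lemma avg_itv_ge p q c : 0 < p -> p <= q -> (forall r, p <= r -> r <= q -> c <= g r) -> 0 <= c ->
  c * (q - p) <= avg (fun r => (p <= r <= q)%R%:R).
Proof.
move=> p0 pq H c0.
have mE : fine (mu `[p, q]) = q - p.
  rewrite lebesgue_measure_itv/= lte_fin; move: pq; rewrite le_eqVlt => /predU1P[->|pq].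
    by rewrite ltxx subrr.
  by rewrite pq.
rewrite -mE -Rintegral_cst// Rintegral_mkcond; apply: le_Rintegral => //.
- have i : mu.-integrable `[p, q] (EFin \o cst c).
    apply: continuous_compact_integrable; first exact: segment_compact.
    by apply: continuous_subspaceT => x; exact: cvg_cst.
  by rewrite -restrict_EFin -integrable_mkcond.
- by apply: avg_integrable; apply: bmeas_ind; exact: measurable_itv_cst.
move=> r _; rewrite patchE mem_setE in_itv/=; case: ifP => [/andP[h1 h2]|_].
  by rewrite mulr1 /g0 (lt_le_trans p0 h1); exact: H.
by rewrite mulr0.
Qed.

End average.

(** * Fronts *)

(** What the study of fronts retains of the tail integral k of K: total mass kappa,
    Lipschitz constant B, and slope at most -m on [-d, d], where K is positive. *)
Record tail_profile {R : realType} (k : R -> R) (kappa B d m : R) : Prop := {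
  tp_ge0 : forall x, 0 <= k x;
  tp_le : forall x, k x <= kappa;
  tp_nincr : forall x y, x <= y -> k y <= k x;
  tp_lip : forall x y, x <= y -> k x - k y <= B * (y - x);
  tp_d : 0 < d;
  tp_m : 0 < m;
  tp_strict : forall x y, - d <= x -> x <= y -> y <= d -> m * (y - x) <= k x - k y;
  tp_sym : forall x, k (- x) = kappa - k x;
  tp_pinfty : forall e, 0 < e -> exists2 D, 0 < D & k D <= e }.

(** The integrand of the balance at time t, as a function of the elapsed time r: beyond
    t, where nothing has happened yet, it carries the initial datum, whose weight is the
    tail mass of the kernel. *)
Definition profile {R : realType} (k u0 y : R -> R) (t r : R) : R :=
  if r <= t then k (y t - y (t - r)) else u0 (y t).

Record front {R : realType} (g k : R -> R) (kappa uT : R) (u0 y : R -> R) : Prop := {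
  fr_cont : continuous y;
  fr_0 : y 0 = 0;
  fr_u0_0 : u0 0 = uT;
  fr_u0_ge0 : forall x, 0 <= u0 x;
  fr_u0_le : forall x, u0 x <= kappa;
  fr_u0_nincr : forall x1 x2, x1 <= x2 -> u0 x2 <= u0 x1;
  fr_eq : forall t, 0 <= t -> avg g (profile k u0 y t) = uT }.

Section profiles.
Context {R : realType}.
Variables (g f : R -> R) (k : R -> R) (kappa B d m : R).
Hypothesis gf : memory_kernel g f.
Hypothesis tk : tail_profile k kappa B d m.

Lemma tail_profile_lip_gt0 : 0 < B.
Proof.
have d0 := tp_d tk; have m0 := tp_m tk.
have h1 : m * (d - 0) <= k 0 - k d by apply: (tp_strict tk); lra.
have h2 : k 0 - k d <= B * (d - 0) by apply: (tp_lip tk); lra.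
have h3 : 0 < m * d by rewrite mulr_gt0.
by rewrite -(pmulr_lgt0 _ d0); lra.
Qed.

Lemma tail_profile_kappa_ge0 : 0 <= kappa.
Proof. exact: le_trans (tp_ge0 tk 0) (tp_le tk 0). Qed.

Lemma tail_profile_shift_le x e : - e <= 0 -> k (x - e) - k x <= B * e.
Proof. by move=> e0; have := @tp_lip _ _ _ _ _ _ tk (x - e) x;
  rewrite opprB addrCA subrr addr0; apply; lra. Qed.

(** The Lipschitz bound, for an increment w that is negative by at most e. *)
Lemma tail_drop_ge x w e : 0 <= e -> - e <= w -> - (B * e) <= k x - k (x + w).
Proof.
move=> e0 ew; have B0 := tail_profile_lip_gt0.
have Be : 0 <= B * e by rewrite mulr_ge0// ltW.
have [w0|w0] := leP 0 w.
  have : k (x + w) <= k x by apply: (tp_nincr tk); lra.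
  lra.
have xw : x + w <= x by lra.
have := tp_lip tk xw; rewrite (_ : x - (x + w) = - w); last by ring.
have : B * - w <= B * e by rewrite ler_pM2l//; lra.
lra.
Qed.

Lemma tail_drop_local x w w' : `|x| <= d / 2 -> 0 <= w' -> w' <= d / 2 -> w' <= w ->
  m * w' <= k x - k (x + w).
Proof.
rewrite ler_norml => /andP[x1 x2] w'0 w'd w'w; have d0 := tp_d tk.
have : k (x + w) <= k (x + w') by apply: (tp_nincr tk); lra.
have := @tp_strict _ _ _ _ _ _ tk x (x + w'); rewrite (_ : x + w' - x = w'); last by ring.
move=> h; have : m * w' <= k x - k (x + w') by apply: h; lra.
lra.
Qed.

Lemma tail_profile_continuous : continuous k.
Proof.
move=> x; have Bp := tail_profile_lip_gt0; apply/cvgrPdist_le => e e0; near=> z.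
have zx : `|x - z| <= e / B.
  near: z; have /cvgrPdist_le h := @cvg_id R (nbhs x).
  by apply: h; rewrite divr_gt0.
have zx' : B * `|x - z| <= e by rewrite mulrC -ler_pdivlMr.
have [xz|zx2] := leP x z.
  rewrite ger0_norm ?subr_ge0 ?(tp_nincr tk)//; apply: le_trans (tp_lip tk xz) _.
  by rewrite -(ger0_norm (_ : 0 <= z - x)) ?subr_ge0// distrC.
rewrite distrC ger0_norm ?subr_ge0 ?(tp_nincr tk) ?(ltW zx2)//;
  apply: le_trans (tp_lip tk (ltW zx2)) _.
by rewrite -(ger0_norm (_ : 0 <= x - z)) ?subr_ge0// ltW.
Unshelve. all: by end_near. Qed.

Variables (uT : R) (u0 y : R -> R).
Hypothesis fr : front g k kappa uT u0 y.

Lemma continuous_increment t : continuous (fun r => k (y t - y (t - r))).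
Proof.
move=> r; apply: (@continuous_comp _ _ _ (fun r => y t - y (t - r)) k);
  last exact: tail_profile_continuous.
apply: cvgB; first exact: cvg_cst.
apply: (@continuous_comp _ _ _ (fun r => t - r) y); last exact: (fr_cont fr).
by apply: cvgB; [exact: cvg_cst|exact: cvg_id].
Qed.

Lemma bmeas_profile t : bmeas (profile k u0 y t).
Proof.
apply: bmeas_if.
- exact: measurable_ler_cst.
- split; first by apply: continuous_measurable_fun; exact: continuous_increment.
  by exists kappa => r; rewrite ger0_norm ?(tp_ge0 tk)// (tp_le tk).
- exact: bmeas_cst.
Qed.

Lemma bmeas_linear c : bmeas (fun r => k (c * r)).
Proof.
split; last by exists kappa => r; rewrite ger0_norm ?(tp_ge0 tk)// (tp_le tk).
apply: continuous_measurable_fun => r.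
apply: (@continuous_comp _ _ _ (fun r => c * r) k); last exact: tail_profile_continuous.
by apply: cvgM; [exact: cvg_cst|exact: cvg_id].
Qed.

(** Reflection of space and exchange of the two states: k (- x) = kappa - k x and the
    kernel has mass one. *)
Lemma front_reflect :
  front g k kappa (kappa - uT) (fun x => kappa - u0 (- x)) (fun t => - y t).
Proof.
split.
- by move=> t; apply: cvgN; exact: (fr_cont fr).
- by rewrite (fr_0 fr) oppr0.
- by rewrite oppr0 (fr_u0_0 fr).
- by move=> x; rewrite subr_ge0 (fr_u0_le fr).
- by move=> x; rewrite lerBlDr lerDl (fr_u0_ge0 fr).
- by move=> x1 x2 h; rewrite lerD2l lerN2; apply: (fr_u0_nincr fr); rewrite lerN2.
move=> t t0; rewrite -(fr_eq fr t0) -[X in X - _](avg_cst gf kappa).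
have -> : profile k (fun x => kappa - u0 (- x)) (fun t => - y t) t =
   (fun r => kappa + (-1) * profile k u0 y t r).
  apply/funext => r; rewrite /profile; case: ifP => _; last by rewrite opprK mulN1r.
  by rewrite -opprD (tp_sym tk) mulN1r.
have bp := bmeas_profile t.
rewrite (avgD gf); [|exact: bmeas_cst|by apply: bmeasM => //; exact: bmeas_cst].
by rewrite (avgZ gf)// mulN1r.
Qed.

Lemma tail_mass_nincr s t : 0 <= s -> s <= t -> f t <= f s.
Proof.
move=> s0 st; have t0 := le_trans s0 st.
have h : 1 - f s <= 1 - f t.
  rewrite -(avg_ler gf s0) -(avg_ler gf t0); apply: (avg_le gf).
  - by apply: bmeas_ind; exact: measurable_ler_cst.
  - by apply: bmeas_ind; exact: measurable_ler_cst.
  move=> r _; have [rs|sr] := leP r s; first by rewrite (le_trans rs st).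
  by rewrite ler0n.
lra.
Qed.

Lemma tail_mass_ge0 t : 0 < t -> 0 <= f t.
Proof.
move=> t0; rewrite -(mk_tail gf t0); apply: Rintegral_ge0 => x /=.
by rewrite in_itv/= andbT => tx; apply: (mk_ge0 gf); exact: lt_le_trans tx.
Qed.

(** Otherwise all means would vanish; by monotonicity the kernel is then positive on a
    whole interval starting at 0. *)
Lemma kernel_positive_somewhere : exists2 p, 0 < p & 0 < g p.
Proof.
apply: contrapT => H.
have g00 r : 0 < r -> g r = 0.
  move=> r0; apply/eqP; rewrite eq_le (mk_ge0 gf r0) andbT leNgt; apply/negP => gr.
  by apply: H; exists r.
have : (1 : R) = 0.
  rewrite -(avg_cst gf 1) /avg -[RHS](avg_cst gf 0) /avg; congr Rintegral.
  by apply/funext => r; rewrite /g0; case: ifP => [/g00 ->|_]; rewrite !mul0r.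
by apply/eqP; rewrite oner_eq0.
Qed.

End profiles.

(** * Monotonicity and equicontinuity of fronts *)

Section monotone.
Context {R : realType}.
Variables (g f : R -> R) (k : R -> R) (kappa B d m : R).
Hypothesis gf : memory_kernel g f.
Hypothesis tk : tail_profile k kappa B d m.
Variables (uT : R) (u0 y : R -> R).
Hypothesis fr : front g k kappa uT u0 y.
Hypothesis uTk : uT < k 0.

(** Otherwise take a highest point a, then a lowest point b after it, and compare the
    means of k 0 - profile at a and at b, both equal to k 0 - uT. Instants between a and
    b contribute nonpositively at b. Each earlier instant contributes nonnegatively at a
    since the front was not above y a, and no more at b than at a: the front at b is lower, and
    the weight is smaller. So the mean at b is at most the one at a, and strictly less
    because of the instants just after a. *)
Lemma front_nondecreasing s t : 0 <= s -> s <= t -> y s <= y t.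
Proof.
move=> s0 st; rewrite leNgt; apply/negP => yts.
have t0 := le_trans s0 st.
have cy : continuous y := fr_cont fr.
have [a] := EVT_max t0 (continuous_subspaceT cy).
rewrite in_itv/= => /andP[a0 at_] amax.
have yas : y s <= y a by apply: amax; rewrite in_itv/= s0.
have [b] := EVT_min at_ (continuous_subspaceT cy).
rewrite in_itv/= => /andP[ab bt] bmin.
have ybt : y b <= y t by apply: bmin; rewrite in_itv/= at_ lexx.
have D0 : 0 < y a - y b by rewrite subr_gt0; lra.
have {}ab : a < b.
  by rewrite lt_neqAle ab andbT; apply/eqP => E; rewrite E subrr ltxx in D0.
set D := y a - y b in D0.
pose h := b - a; have h0 : 0 < h by rewrite subr_gt0.
have b0 : 0 <= b by rewrite ltW// (le_lt_trans a0 ab).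
have ya0 : 0 <= y a by rewrite -(fr_0 fr); apply: amax; rewrite in_itv/= lexx.
have u0a : u0 (y a) <= uT by rewrite -(fr_u0_0 fr); exact: (fr_u0_nincr fr).
have bpa := bmeas_profile tk fr a; have bpb := bmeas_profile tk fr b.
have low r : 0 < r -> r <= h -> k 0 <= profile k u0 y b r.
  move=> r0 rh; rewrite /profile ifT; last by rewrite (le_trans rh)// /h; lra.
  by apply: (tp_nincr tk); rewrite subr_le0; apply: bmin; rewrite in_itv/=; apply/andP;
    split; rewrite /h in rh; lra.
have avgE (t' : R) : 0 <= t' -> bmeas (profile k u0 y t') ->
    avg g (fun r => k 0 + (-1) * profile k u0 y t' r) = k 0 - uT.
  move=> t'0 bp; rewrite (avgD gf); [|exact: bmeas_cst|by apply: bmeasM => //; exact: bmeas_cst].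
  by rewrite (avg_cst gf) (avgZ gf)// (fr_eq fr)// mulN1r.
have bk (t' : R) : bmeas (profile k u0 y t') -> bmeas (fun r => k 0 + (-1) * profile k u0 y t' r).
  by move=> bp; apply: bmeasD; [exact: bmeas_cst|apply: bmeasM => //; exact: bmeas_cst].
(* If the kernel vanishes beyond h, only instants between a and b count at b. *)
have := mk_ge0 gf h0; rewrite le_eqVlt => /predU1P[gh|gh].
  have : avg g (fun r => k 0 + (-1) * profile k u0 y b r) <= avg g (fun=> 0).
    apply: (avg_le_shift gf (h := 0)); [exact: bk|exact: bmeas_cst|].
    move=> r; rewrite mulr0 /g0; case: ifP => r0; last by rewrite mul0r.
    have [rh|hr] := leP r h; last first.
      have -> : g r = 0; last by rewrite mul0r.
      by apply/eqP; rewrite eq_le (mk_ge0 gf r0) andbT gh; apply: (mk_nincr gf) => //; exact: ltW.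
    have := low r r0 rh; have := mk_ge0 gf r0; nra.
  by rewrite avgE// (avg_cst gf); have := uTk; lra.
(* sg times the mass of J is the strict gain from the instants just after a. *)
pose D' := Num.min (D / 2) d.
have D'0 : 0 < D' by rewrite lt_min divr_gt0//= (tp_d tk).
have D'D : D' <= D / 2 by rewrite ge_min lexx.
have D'd : D' <= d by rewrite ge_min lexx orbT.
pose sg := k (- D') - k 0.
have sg0 : 0 < sg.
  have := tp_strict tk (x := - D') (y := 0); have m0 := tp_m tk; have d0 := tp_d tk.
  have : 0 < m * (0 - - D') by rewrite mulr_gt0//; lra.
  by move=> h1 h2; apply: (lt_le_trans h1); apply: h2; lra.
have [e0 e00 eP] : exists2 e, 0 < e & forall s', `|s' - a| < e -> y a - D / 2 <= y s'.
  have := cy a => /cvgrPdist_lt/(_ (D / 2)); rewrite divr_gt0// => /(_ isT)[e /= e0 He].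
  exists e => // s' hs; have := He s'; rewrite /= distrC => /(_ hs).
  by rewrite ltr_norml => /andP[_ h2]; lra.
pose eta := Num.min (e0 / 2) (h / 2).
have eta0 : 0 < eta by rewrite lt_min !divr_gt0.
have etah : eta <= h / 2 by rewrite ge_min lexx orbT.
have etae : eta <= e0 / 2 by rewrite ge_min lexx.
pose J r := h - eta <= r <= h.
have bJ : bmeas (fun r => (J r)%:R : R) by apply: bmeas_ind; exact: measurable_itv_cst.
have bsJ : bmeas (fun r => sg * (J r)%:R) by apply: bmeasM => //; exact: bmeas_cst.
have : avg g (fun r => (k 0 + (-1) * profile k u0 y b r) + sg * (J r)%:R) <=
       avg g (fun r => k 0 + (-1) * profile k u0 y a r).
  apply: (avg_le_shift gf (h := - h)); [by apply: bmeasD => //; exact: bk|exact: bk|].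
  move=> r; have [r0|r0] := leP r 0.
    by rewrite {1}/g0 ltNge r0 mul0r /g0 ltNge (_ : r - h <= 0) ?mul0r//; lra.
  have g0r := g0_ge0 gf r.
  have [rh|hr] := leP r h.
    rewrite {2}/g0 [0 < r - h]ltNge (_ : r - h <= 0)/= ?mul0r; last by lra.
    apply: mulr_ge0_le0 => //; have hl := low r r0 rh.
    case hJ : (J r); last by rewrite mulr0; lra.
    move: hJ => /andP[J1 J2]; rewrite mulr1 /sg.
    suff : k (- D') <= profile k u0 y b r by lra.
    rewrite /profile ifT; last by rewrite (le_trans rh)// /h; lra.
    apply: (tp_nincr tk).
    have : y a - D / 2 <= y (b - r).
      have hE : h = b - a by [].
      by apply: eP; rewrite ger0_norm; lra.
    by rewrite /D in D'D *; lra.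
  have -> : J r = false by rewrite /J [r <= h]leNgt hr andbF.
  rewrite mulr0 addr0.
  have rh0 : 0 < r - h by lra.
  have gg : g0 g r <= g0 g (r - h) by apply: (g0_nincr gf); lra.
  have E : b - r = a - (r - h) by rewrite /h; ring.
  have [p1 p2] : profile k u0 y a (r - h) <=
    profile k u0 y b r /\ profile k u0 y a (r - h) <= k 0.
    rewrite /profile (_ : (r - h <= a) = (r <= b)); last by rewrite /h; apply/idP/idP; lra.
    case: ifP => rb.
      rewrite E; split; apply: (tp_nincr tk); first by rewrite lerD2r -subr_ge0 ltW.
      by rewrite subr_ge0; apply: amax; rewrite in_itv/= -E; apply/andP; split; rewrite /h; lra.
    split; last by apply: (le_trans u0a); exact: ltW.
    by apply: (fr_u0_nincr fr); rewrite -subr_ge0 ltW.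
  apply: (@le_trans _ _ (g0 g r * (k 0 + -1 * profile k u0 y a (r - h)))).
    by rewrite ler_wpM2l// lerD2l !mulN1r lerN2.
  by rewrite ler_wpM2r// mulN1r subr_ge0.
rewrite (avgD gf)//; last exact: bk.
rewrite !avgE// (avgZ gf)// gerDl => hneg.
have : g h * (h - (h - eta)) <= avg g (fun r => (J r)%:R).
  apply: (avg_itv_ge gf); [lra|lra| |exact: ltW].
  by move=> r r1 r2; apply: (mk_nincr gf) => //; lra.
have : 0 < g h * (h - (h - eta)) by rewrite mulr_gt0//; lra.
move=> h1 h2; have : 0 < sg * avg g (fun r => (J r)%:R) by rewrite mulr_gt0// (lt_le_trans h1).
lra.
Qed.

(** Compare the balances at s and t. The advance from s to t lowers all terms that look
    back before s, by m de at least for the instants in [s - eta, s]; only the instants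
    after s, of mass 1 - f (t - s), can compensate. *)
Lemma increment_le_increment s t eta de : 0 < eta -> eta <= s -> s < t -> 0 < de -> de <= d / 2 ->
  y s - y (s - eta) <= de -> de <= y t - y s ->
  m * de * (1 - f eta) <= kappa * (1 - f (t - s)).
Proof.
move=> eta0 etas st de0 ded hs ht.
have s0 : 0 <= s by rewrite (le_trans (ltW eta0)).
have T0 : 0 <= t - s by rewrite subr_ge0 ltW.
have t0 : 0 <= t by rewrite (le_trans s0) ?ltW.
have bps := bmeas_profile tk fr s; have bpt := bmeas_profile tk fr t.
have bi (c q : R) : bmeas (fun r : R => c * (r <= q)%R%:R).
  by apply: bmeasM; [exact: bmeas_cst|apply: bmeas_ind; exact: measurable_ler_cst].
have bi1 (q : R) : bmeas (fun r : R => (r <= q)%R%:R : R) by apply: bmeas_ind;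
  exact: measurable_ler_cst.
have : avg g (fun r => profile k u0 y t r + (- kappa) * (r <= t - s)%R%:R) <=
       avg g (fun r => profile k u0 y s r + (- (m * de)) * (r <= eta)%R%:R).
  apply: (avg_le_shift gf (h := - (t - s))); [exact: bmeasD|exact: bmeasD|].
  move=> r; set r' := r - (t - s).
  have [r0|r0] := leP r 0.
    by rewrite {1}/g0 ltNge r0 mul0r /g0 ltNge (_ : r' <= 0) ?mul0r// /r'; lra.
  have g0r := g0_ge0 gf r.
  have pk : profile k u0 y t r <= kappa.
    by rewrite /profile; case: ifP => _; [exact: (tp_le tk)|exact: (fr_u0_le fr)].
  have p0 : 0 <= profile k u0 y t r.
    by rewrite /profile; case: ifP => _; [exact: (tp_ge0 tk)|exact: (fr_u0_ge0 fr)].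
  have [rT|Tr] := leP r (t - s).
    rewrite {2}/g0 [0 < r']ltNge (_ : r' <= 0)/= ?mul0r; last by rewrite /r'; lra.
    by rewrite mulr1; apply: mulr_ge0_le0 => //; lra.
  rewrite mulr0 addr0.
  have r'0 : 0 < r' by rewrite /r'; lra.
  have gg : g0 g r <= g0 g r' by apply: (g0_nincr gf) => //; rewrite /r'; lra.
  apply: (@le_trans _ _ (g0 g r' * profile k u0 y t r)); first by rewrite ler_wpM2r.
  apply: ler_wpM2l; first exact: (g0_ge0 gf).
  rewrite /profile (_ : (r' <= s) = (r <= t)); last by rewrite /r'; apply/idP/idP; lra.
  case: ifP => rt; last first.
    rewrite (_ : r' <= eta = false) ?mulr0 ?addr0.
      by apply: (fr_u0_nincr fr); lra.
    apply/negbTE; rewrite -ltNge; move/negbT: rt; rewrite -ltNge /r'; lra.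
  have E : t - r = s - r' by rewrite /r'; ring.
  rewrite E; set X := y s - y (s - r').
  have h1 : k (y t - y (s - r')) <= k (X + de) by apply: (tp_nincr tk); rewrite /X; lra.
  apply: (le_trans h1); have [r'e|er'] := leP r' eta; last first.
    by rewrite mulr0 addr0; apply: (tp_nincr tk); lra.
  have X0 : 0 <= X.
    rewrite subr_ge0; apply: front_nondecreasing; [|lra].
    by rewrite subr_ge0; rewrite /r'; lra.
  have Xd : X <= de.
    apply: le_trans hs; rewrite lerD2l lerN2; apply: front_nondecreasing; lra.
  have dd := tp_d tk.
  have := @tp_strict _ _ _ _ _ _ tk X (X + de); rewrite (_ : X + de - X = de); last by ring.
  move=> h2; have {}h2 : m * de <= k X - k (X + de) by apply: h2; lra.
  by rewrite mulr1; lra.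
rewrite !(avgD gf)// !(fr_eq fr)// !(avgZ gf)// !(avg_ler gf)//; last exact: ltW.
lra.
Qed.

(** At time t, the instants before s contribute at most k D <= uT / 2 each, and the initial
    datum at most uT. *)
Lemma large_increment_time s t D : 0 <= s -> s < t -> 1 <= t -> k D <= uT / 2 -> 0 <= uT ->
  D <= y t - y s -> uT / 2 * (1 - f 1) <= kappa * (1 - f (t - s)).
Proof.
move=> s0 st t1 kD uT0 hD.
have t0 : 0 <= t by lra.
have T0 : 0 <= t - s by lra.
have bpt := bmeas_profile tk fr t.
have bi (c q : R) : bmeas (fun r : R => c * (r <= q)%R%:R).
  by apply: bmeasM; [exact: bmeas_cst|apply: bmeas_ind; exact: measurable_ler_cst].
have bi1 (q : R) : bmeas (fun r : R => (r <= q)%R%:R : R) by apply: bmeas_ind;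
  exact: measurable_ler_cst.
have yt0 : 0 <= y t by rewrite -(fr_0 fr); exact: front_nondecreasing.
have k0 := tail_profile_kappa_ge0 tk.
have : avg g (profile k u0 y t) <=
  avg g (fun r => (uT + (- (uT / 2)) * (r <= t)%R%:R) + kappa * (r <= t - s)%R%:R).
  apply: (avg_le gf) => //.
    by apply: bmeasD => //; apply: bmeasD => //; exact: bmeas_cst.
  move=> r r0; rewrite /profile; have [rt|tr] := leP r t; last first.
    rewrite mulr0 addr0 (_ : r <= t - s = false) ?mulr0 ?addr0; last by apply/negbTE;
      rewrite -ltNge; lra.
    by rewrite -(fr_u0_0 fr); exact: (fr_u0_nincr fr).
  have [rT|Tr] := leP r (t - s); first by have := tp_le tk (y t - y (t - r)); rewrite !mulr1; lra.
  rewrite mulr0 mulr1 addr0; apply: (@le_trans _ _ (k D)); last by lra.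
  apply: (tp_nincr tk); apply: (le_trans hD); rewrite lerD2l lerN2.
  by apply: front_nondecreasing; lra.
rewrite (fr_eq fr)// (avgD gf)//; last by apply: bmeasD => //; exact: bmeas_cst.
rewrite (avgD gf)//; last exact: bmeas_cst.
rewrite (avg_cst gf) !(avgZ gf)// !(avg_ler gf)//.
have := tail_mass_nincr gf ler01 t1; nra.
Qed.

Lemma initial_mass_small e : 0 < e -> exists2 q, 0 < q & forall r, 0 <= r -> r <=
  q -> 1 - f r < e.
Proof.
move=> e0; have := mk_cvg0 gf => /cvgrPdist_lt/(_ e e0)[q /= q0 H].
exists (q / 2) => [|r r0 rq]; first by rewrite divr_gt0.
move: r0; rewrite le_eqVlt => /predU1P[<-|r0]; first by rewrite (mk_f0 gf) subrr.
have := H r; rewrite /= sub0r normrN gtr0_norm// => /(_ _ r0).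
by move=> h; apply: le_lt_trans (h _); [exact: ler_norm|lra].
Qed.

(** If the front advances by de during [s, s + tau] and tau is small, then
    [increment_le_increment] forces it to have advanced by de shortly before s already;
    tau is chosen backwards, from the last link of the chain to the first. *)
Lemma increment_cascade de n : 0 < de -> de <= d / 2 -> forall eta, 0 < eta ->
  exists tau, [/\ 0 < tau, tau <= eta & forall s, n%:R * eta <= s -> de <= y (s + tau) - y s ->
    n.+1%:R * de <= y (s + tau) - y (s - n%:R * eta)].
Proof.
move=> de0 ded; elim: n => [|n ih] eta eta0.
  by exists eta; split => // s _; rewrite mul0r subr0 mul1r.
have [tn [tn0 tne H]] := ih eta eta0.
have c0 : 0 < m * de * (1 - f tn).
  by rewrite !mulr_gt0 ?(tp_m tk)// subr_gt0 (mk_lt1 gf).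
have kp : 0 < kappa + 1 by have := tail_profile_kappa_ge0 tk; lra.
have [q q0 Hq] := initial_mass_small (divr_gt0 c0 kp).
pose tau := Num.min eta q.
have tau0 : 0 < tau by rewrite lt_min eta0.
exists tau; split => // [|s sn hs]; first by rewrite ge_min lexx.
have n0 : 0 <= n%:R * eta by rewrite mulr_ge0// ltW.
rewrite -natr1 mulrDl mul1r in sn.
have hh : de < y s - y (s - tn).
  rewrite ltNge; apply/negP => hle.
  have := @increment_le_increment s (s + tau) tn de tn0 _ _ de0 ded hle hs.
  rewrite (_ : s + tau - s = tau); last by ring.
  have h1 : 1 - f tau < m * de * (1 - f tn) / (kappa + 1).
    by apply: Hq; [exact: ltW|rewrite ge_min lexx orbT].
  rewrite ltr_pdivlMr// in h1.
  have f1 : 0 < 1 - f tau by rewrite subr_gt0 (mk_lt1 gf).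
  move=> h2; have : m * de * (1 - f tn) <= kappa * (1 - f tau) by apply: h2; lra.
  nra.
have := H (s - tn); rewrite subrK => /(_ _ (ltW hh)) => h3.
have {}h3 : n.+1%:R * de <= y s - y (s - tn - n%:R * eta) by apply: h3; lra.
have h4 : y (s - (n%:R + 1) * eta) <= y (s - tn - n%:R * eta).
  apply: front_nondecreasing; rewrite mulrDl mul1r; lra.
by rewrite -[n.+2%:R]natr1 mulrDl mul1r -[X in s - X * _]natr1; lra.
Qed.

Lemma front_small_increments de : 0 < uT -> 0 < de ->
  exists2 tau, 0 < tau & forall s r, 1 <= s -> 0 <= r -> r <= tau -> y (s + r) - y s <= de.
Proof.
move=> uT0 de0'; pose de' := Num.min de (d / 2).
have de0 : 0 < de' by rewrite lt_min de0' divr_gt0// (tp_d tk).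
have ded : de' <= d / 2 by rewrite ge_min lexx orbT.
have dee : de' <= de by rewrite ge_min lexx.
have uT2 : 0 < uT / 2 by rewrite divr_gt0.
have [D D0 kD] := tp_pinfty tk uT2.
pose N := Num.truncn (D / de').
have ND : D <= N.+1%:R * de' by rewrite -ler_pdivrMr//; apply: ltW; exact: truncnS_gt.
have kp : 0 < kappa + 1 by have := tail_profile_kappa_ge0 tk; lra.
have c0 : 0 < uT / 2 * (1 - f 1) by rewrite mulr_gt0 ?divr_gt0// subr_gt0 (mk_lt1 gf).
have [q q0 Hq] := initial_mass_small (divr_gt0 c0 kp).
pose eta := Num.min q 1 / N.+1%:R.
have q1 : 0 < Num.min q 1 by rewrite lt_min q0 ltr01.
have eta0 : 0 < eta by rewrite divr_gt0.
have etaE : N%:R * eta + eta = Num.min q 1.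
  by rewrite /eta -natr1; field; rewrite natr1 pnatr_eq0.
have qq : Num.min q 1 <= q by rewrite ge_min lexx.
have q1' : Num.min q 1 <= 1 by rewrite ge_min lexx orbT.
have [tau [tau0 taue H]] := increment_cascade N de0 ded eta0.
exists tau => // s r s1 r0 rt.
apply: (@le_trans _ _ (y (s + tau) - y s)).
  by rewrite lerD2r; apply: front_nondecreasing; lra.
apply: le_trans dee; rewrite leNgt; apply/negP => hs.
have := H s _ (ltW hs) => /(_ _) h1.
have {}h1 : N.+1%:R * de' <= y (s + tau) - y (s - N%:R * eta) by apply: h1; lra.
have := @large_increment_time (s - N%:R * eta) (s + tau) D _ _ _ kD (ltW uT0) (le_trans ND h1).
set T := s + tau - _ => h2.
have Ne : 0 <= N%:R * eta by rewrite mulr_ge0// ltW.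
have T0 : 0 < T by rewrite /T; lra.
have {}h2 : uT / 2 * (1 - f 1) <= kappa * (1 - f T) by apply: h2; lra.
have h3 : 1 - f T < uT / 2 * (1 - f 1) / (kappa + 1).
  by apply: Hq; [exact: ltW|rewrite /T; lra].
rewrite ltr_pdivlMr// in h3.
have : 0 < 1 - f T by rewrite subr_gt0 (mk_lt1 gf).
nra.
Qed.

End monotone.

(** * The upper limit of the increments *)

(** Uniform continuity on [1, +oo[. *)
Definition late_ucont {R : realType} (y : R -> R) := forall de, 0 < de -> exists2 tau, 0 < tau &
  forall s r, 1 <= s -> 0 <= r -> r <= tau -> `|y (s + r) - y s| <= de.

Lemma limsup_exists {R : realType} (q : R -> R) (C : R) :
  (forall t, 1 <= t -> `|q t| <= C) ->
  exists M, (forall e, 0 < e -> exists T, forall t, T <= t -> q t <= M + e) /\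
    (forall e T, 0 < e -> exists2 t, T <= t & M - e <= q t).
Proof.
move=> H; pose E := [set x : R | exists T, forall t, T <= t -> q t <= x].
have EC : E C by exists 1 => t t1; apply: le_trans (H t t1); exact: ler_norm.
have lbE : lbound E (- C).
  move=> x [T HT]; pose t := Num.max T 1.
  have h1 := HT t; rewrite le_max lexx in h1; have {}h1 := h1 isT.
  have h2 := H t; rewrite le_max lexx orbT in h2; have := h2 isT.
  by rewrite ler_norml => /andP[h3 _]; exact: le_trans h1.
have hinf : has_inf E by split; [exists C|exists (- C)].
exists (inf E); split=> [e e0|e T e0].
  have [x [T HT] xe] := inf_adherent e0 hinf.
  by exists T => t /HT; move/le_trans; apply; exact: ltW.
apply: contrapT => h.
have : E (inf E - e).
  exists T => t Tt; rewrite leNgt; apply/negP => lt; apply: h; exists t => //.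
  exact: ltW.
by move=> /(ge_inf hinf.2); rewrite lerBrDr gerDl leNgt e0.
Qed.

Section asymptotics.
Context {R : realType}.
Variables (g f : R -> R) (k : R -> R) (kappa B d m : R).
Hypothesis gf : memory_kernel g f.
Hypothesis tk : tail_profile k kappa B d m.
Variables (uT : R) (u0 y : R -> R).
Hypothesis fr : front g k kappa uT u0 y.
Hypothesis uc : late_ucont y.
Variables (h M : R).
Hypothesis h0 : 0 < h.
Let inc t := y (t + h) - y t.
Hypothesis Mub : forall e, 0 < e -> exists T, forall t, T <= t -> inc t <= M + e.
Hypothesis Mfreq : forall e T, 0 < e -> exists2 t, T <= t & M - e <= inc t.

Lemma tail_mass_small e : 0 < e -> exists2 T, 1 <= T & forall t, T <= t -> f t < e.
Proof.
move=> e0; have := mk_pinfty gf => /cvgrPdist_lt/(_ e e0)[T [_ H]].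
exists (Num.max 1 (T + 1)); first by rewrite le_max lexx.
move=> t; rewrite ge_max => /andP[_ Tt].
have := H t; rewrite sub0r normrN => /(_ _); have Tt' : T < t by lra.
by move=> /(_ Tt'); apply: le_lt_trans; exact: ler_norm.
Qed.

Lemma increment_modulus e : 0 < e -> exists2 tau, 0 < tau &
  forall t r1 r, 1 <= t - r -> r1 <= r -> r <= r1 + tau -> inc (t - r) <= inc (t - r1) + e.
Proof.
move=> e0; have e2 : 0 < e / 2 by rewrite divr_gt0.
have [tau tau0 H] := uc e2; exists tau => // t r1 r tr r1r rt.
have hp := h0; have q0 : 0 <= r - r1 by rewrite subr_ge0.
have qt : r - r1 <= tau by lra.
have th : 1 <= t - r + h by lra.
have := H _ _ tr q0 qt; have := H _ _ th q0 qt.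
rewrite (_ : t - r + (r - r1) = t - r1); last by ring.
rewrite (_ : t - r + h + (r - r1) = t - r1 + h); last by ring.
by rewrite /inc !ler_norml => /andP[a1 a2] /andP[b1 b2]; lra.
Qed.

(** A larger increment at t than at t - r lowers the profile. *)
Lemma profile_drop t r : 0 <= t -> r <= t ->
  profile k u0 y t r - profile k u0 y (t + h) r =
  k (y t - y (t - r)) - k (y t - y (t - r) + (inc t - inc (t - r))).
Proof.
move=> t0 rt; rewrite /profile rt ifT; last by rewrite (le_trans rt)// lerDl ltW.
congr (_ - k _); rewrite /inc (_ : t - r + h = t + h - r); first by ring.
by ring.
Qed.

Lemma profile_drop_ge t r :
  - kappa <= profile k u0 y t r - profile k u0 y (t + h) r.
Proof.
have l1 : 0 <= profile k u0 y t r.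
  by rewrite /profile; case: ifP => _; [exact: (tp_ge0 tk)|exact: (fr_u0_ge0 fr)].
have l2 : profile k u0 y (t + h) r <= kappa.
  by rewrite /profile; case: ifP => _; [exact: (tp_le tk)|exact: (fr_u0_le fr)].
lra.
Qed.

(** The mean of the difference of the profiles at t and t + h is zero. A definite drop gam
    on [r1, r2] must therefore be compensated by the small errors: e for the elapsed times
    up to Rg, kappa for the others. *)
Lemma drops_le_error t Rg r1 r2 c e gam : 0 <= t -> 0 <= Rg -> Rg <= t ->
  0 < r1 -> r1 <= r2 -> r2 <= Rg -> 0 <= c -> (forall r, r1 <= r -> r <= r2 -> c <= g r) ->
  0 <= e -> 0 <= gam ->
  (forall r, r <= Rg -> - e <= inc t - inc (t - r)) ->
  (forall r, r1 <= r -> r <= r2 ->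
     gam <= profile k u0 y t r - profile k u0 y (t + h) r) ->
  gam * (c * (r2 - r1)) <= kappa * f Rg + B * e.
Proof.
move=> t0 Rg0 Rgt r10 r12 r2R c0 cg e0 gam0 He Hg.
have Be : 0 <= B * e by rewrite mulr_ge0// ltW// (tail_profile_lip_gt0 tk).
have th0 : 0 <= t + h by rewrite addr_ge0// ltW.
pose J r := r1 <= r <= r2.
have bJ : bmeas (fun r => (J r)%:R : R) by apply: bmeas_ind; exact: measurable_itv_cst.
have bR : bmeas (fun r : R => (r <= Rg)%R%:R : R) by apply: bmeas_ind; exact: measurable_ler_cst.
have b1 := bmeas_profile tk fr t; have b2 := bmeas_profile tk fr (t + h).
have bc (x : R) : bmeas (fun _ : R => x) by exact: bmeas_cst.
have bkR : bmeas (fun r : R => kappa * (r <= Rg)%R%:R) by apply: bmeasM.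
have bgJ : bmeas (fun r => gam * (J r)%:R) by apply: bmeasM.
have bm2 : bmeas (fun r => (-1) * profile k u0 y (t + h) r) by apply: bmeasM.
have bs : bmeas (fun r => kappa * (r <= Rg)%R%:R + gam * (J r)%:R) by apply: bmeasD.
have ble : avg g (fun r => (- kappa - B * e) + (kappa * (r <= Rg)%R%:R + gam * (J r)%:R)) <=
    avg g (fun r => profile k u0 y t r + (-1) * profile k u0 y (t + h) r).
  apply: (avg_le gf); [exact: bmeasD|exact: bmeasD|].
  move=> r rpos; rewrite mulN1r.
  case hJ : (J r).
    move: hJ => /andP[J1 J2]; rewrite (le_trans J2 r2R) !mulr1.
    by have := Hg r J1 J2; lra.
  have [rR|Rr] := leP r Rg; last by have := profile_drop_ge t r; rewrite !mulr0; lra.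
  rewrite mulr1 mulr0 profile_drop//; last exact: le_trans Rgt.
  by have := tail_drop_ge tk (y t - y (t - r)) e0 (He r rR); lra.
rewrite (avgD gf (bc _) bs) (avgD gf b1 bm2) in ble.
rewrite (avgD gf bkR bgJ) (avg_cst gf) !(avgZ gf) // (avg_ler gf Rg0) in ble.
rewrite (fr_eq fr t0) (fr_eq fr th0) in ble.
have : gam * (c * (r2 - r1)) <= gam * avg g (fun r => (J r)%:R).
  by apply: ler_wpM2l => //; apply: (avg_itv_ge gf).
lra.
Qed.

(** Strong maximum principle. For elapsed times up to Rg the increments exceed M by
    little, so the profile cannot rise much from t to t + h; if the increment at t - r1 were
    below M by e, then by equicontinuity it would stay so on an interval of times and the
    profile would drop there by a definite amount. *)
Lemma near_max_backward : exists2 r0, 0 < r0 & forall e, 0 < e -> exists e' T, 0 < e' /\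
  forall t, T <= t -> M - e' <= inc t -> forall r, 0 <= r -> r <= r0 -> M - e <= inc (t - r).
Proof.
have [p0 p00 gp0] := kernel_positive_somewhere gf.
have d0 := tp_d tk; have m0 := tp_m tk; have B0 := tail_profile_lip_gt0 tk.
have kappa0 := tail_profile_kappa_ge0 tk.
have [tau1 tau10 H1] := uc (divr_gt0 d0 (ltr0Sn R 1)).
pose r0 := Num.min p0 tau1 / 2.
have r00 : 0 < r0 by rewrite divr_gt0// lt_min p00.
have r0p : 2 * r0 <= p0 by rewrite mulrC divfK ?ge_min ?lexx.
have r0t : 2 * r0 <= tau1 by rewrite mulrC divfK ?ge_min ?lexx ?orbT.
exists r0 => // e e0.
have e4 : 0 < e / 4 by rewrite divr_gt0.
have [tau2 tau20 H2] := increment_modulus e4.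
pose eta := Num.min r0 tau2.
have eta0 : 0 < eta by rewrite lt_min r00.
have etar : eta <= r0 by rewrite ge_min lexx.
have etat : eta <= tau2 by rewrite ge_min lexx orbT.
pose w' := Num.min (e / 2) (d / 2).
have w'1 : w' <= e / 2 by rewrite ge_min lexx.
have w'2 : w' <= d / 2 by rewrite ge_min lexx orbT.
have w'0 : 0 < w' by rewrite lt_min !divr_gt0.
have gam0 : 0 < m * w' by rewrite mulr_gt0.
(* What a drop of the increment by e costs in the balance: the two error terms,
   from the far memory and from the excess over M, are made smaller than it. *)
pose cost := m * w' * (g p0 * (eta / 2)).
have cost0 : 0 < cost by rewrite !mulr_gt0// invr_gt0.
pose e' := Num.min (e / 4) (cost / (4 * B)).
have e'0 : 0 < e' by rewrite lt_min !divr_gt0// mulr_gt0.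
have e'e : e' <= e / 4 by rewrite ge_min lexx.
have e'B : B * (2 * e') <= cost / 2.
  have : e' <= cost / (4 * B) by rewrite ge_min lexx orbT.
  by rewrite ler_pdivlMr ?mulr_gt0// => hh; lra.
have kp : 0 < 4 * (kappa + 1) by lra.
have [R1 R11 HR] := tail_mass_small (divr_gt0 cost0 kp).
pose Rg := Num.max R1 (2 * r0).
have Rg1 : R1 <= Rg by rewrite le_max lexx.
have Rg2 : 2 * r0 <= Rg by rewrite le_max lexx orbT.
have fR := HR Rg Rg1; rewrite ltr_pdivlMr// in fR.
have Rg0 : 0 < Rg by lra.
have far : kappa * f Rg <= cost / 4 by have := tail_mass_ge0 gf Rg0; nra.
have [T1 HT1] := Mub e'0.
exists e', (Num.max T1 1 + Rg); split => // t Tt ht r1 r10 r1r.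
have Tt1 : T1 + Rg <= t by apply: le_trans Tt; rewrite lerD2r le_max lexx.
have Tt2 : 1 + Rg <= t by apply: le_trans Tt; rewrite lerD2r le_max lexx orbT.
have costE : m * w' * (g p0 * (eta / 2)) = cost by [].
clear Tt fR kp gam0; clearbody cost e' Rg w' eta r0.
have t0 : 0 <= t by lra.
have Rgt : Rg <= t by lra.
have e2' : 0 <= 2 * e' by rewrite mulr_ge0// ltW.
have low r : r <= Rg -> - (2 * e') <= inc t - inc (t - r).
  by move=> rR; have hh : inc (t - r) <= M + e' by [apply: HT1; lra]; lra.
rewrite leNgt; apply/negP => hlt.
have drop r : r1 + eta / 2 <= r -> r <= r1 + eta ->
    m * w' <= profile k u0 y t r - profile k u0 y (t + h) r.
  move=> ra rb; have rR : r <= Rg by lra.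
  have tr : 1 <= t - r by lra.
  have ra' : r1 <= r by lra.
  have rb' : r <= r1 + tau2 by lra.
  rewrite profile_drop ?(le_trans rR)//; apply: (tail_drop_local tk) => //; last first.
  - by have := H2 t r1 r tr ra' rb'; lra.
  - exact: ltW.
  have rp : 0 <= r by lra.
  have rt : r <= tau1 by lra.
  by have := H1 (t - r) r tr rp rt; rewrite subrK.
have gp r : r1 + eta / 2 <= r -> r <= r1 + eta -> g p0 <= g r.
  by move=> ra rb; apply: (mk_nincr gf); lra.
have s1 : 0 < r1 + eta / 2 by lra.
have s2 : r1 + eta / 2 <= r1 + eta by lra.
have s3 : r1 + eta <= Rg by lra.
have mw : 0 <= m * w' by rewrite mulr_ge0// ltW.
have := drops_le_error t0 (ltW Rg0) Rgt s1 s2 s3 (ltW gp0) gp e2' mw low drop.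
rewrite (_ : r1 + eta - (r1 + eta / 2) = eta / 2); last by field.
by rewrite costE => hfin; lra.
Qed.

Lemma near_max_long (L : R) : forall e, 0 < e -> exists e' T, 0 < e' /\
  forall t, T <= t -> M - e' <= inc t -> forall r, 0 <= r -> r <= L -> M - e <= inc (t - r).
Proof.
have [r0 r00 H] := near_max_backward.
suff {L} P n : forall e, 0 < e -> exists e' T, 0 < e' /\
  forall t, T <= t -> M - e' <= inc t -> forall r, 0 <= r -> r <= n%:R * r0 -> M - e <=
    inc (t - r).
  move=> e e0; have [e' [T [e'0 HT]]] := P (Num.truncn (L / r0)).+1 e e0.
  exists e', T; split => // t Tt ht r r1 rL; apply: HT => //.
  by apply: (le_trans rL); rewrite -ler_pdivrMr// ltW// truncnS_gt.
elim: n => [|n ih] e e0.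
  exists e, 0; split => // t _ ht r r1 r2.
  by rewrite (_ : r = 0) ?subr0//; apply/eqP; rewrite eq_le r1 -(mul0r r0) r2.
have [e1 [T1 [e10 HT1]]] := ih e e0.
have [e2 [T2 [e20 HT2]]] := H e1 e10.
exists e2, (Num.max T2 (T1 + r0)); split => // t.
rewrite ge_max => /andP[t1 t2] ht r r1 r2; rewrite -natr1 mulrDl mul1r in r2.
pose r' := Num.min r r0.
have r'r : r' <= r by rewrite ge_min lexx.
have r'r0 : r' <= r0 by rewrite ge_min lexx orbT.
have r'1 : 0 <= r' by rewrite le_min r1 ltW.
have r'2 : r - r' <= n%:R * r0.
  have nr : 0 <= n%:R * r0 by rewrite mulr_ge0// ltW.
  rewrite /r' minEle; case: ifP => rr; first by rewrite subrr.
  lra.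
have h1 := HT2 t t1 ht r' r'1 r'r0.
have := HT1 (t - r') _ h1 (r - r'); rewrite (_ : t - r' - (r - r') = t - r); last by ring.
apply; lra.
Qed.

(** Start from a time t whose increment is nearly M, and put v = M / h. On a long interval
    before t + h, the function q s = y s - v s nearly does not decrease from s to s + h, so
    that its maximum s on [t, t + h] is nearly a maximum over the long past. The balance at
    s then gives uT <= avg (k (v r)), and the mean of k (v r) strictly decreases in v. *)
Lemma limsup_increment_le (c : R) : avg g (fun r => k (c * r)) = uT -> M <= c * h.
Proof.
move=> hc; pose v := M / h.
have d0 := tp_d tk; have m0 := tp_m tk; have B0 := tail_profile_lip_gt0 tk.
have kappa0 := tail_profile_kappa_ge0 tk.
have ME : M = v * h by rewrite /v divfK// gt_eqF.
have bv := bmeas_linear tk v; have bcc := bmeas_linear tk c.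
have bc (x : R) : bmeas (fun _ : R => x) by exact: bmeas_cst.
have key : uT <= avg g (fun r => k (v * r)).
  apply/ler_addgt0Pr => rho rho0.
  have kp : 0 < 2 * (kappa + 1) by lra.
  have [T1 T11 HT1] := tail_mass_small (divr_gt0 rho0 kp).
  pose Jn := (Num.truncn (T1 / h)).+1.
  have JT : T1 <= Jn%:R * h by rewrite -ler_pdivrMr// ltW// truncnS_gt.
  have fJ := HT1 _ JT; rewrite ltr_pdivlMr// in fJ.
  have Jp : 0 < Jn%:R :> R by rewrite ltr0n.
  pose e := rho / (2 * B * Jn%:R).
  have e0 : 0 < e by rewrite divr_gt0// !mulr_gt0.
  have eE : B * (Jn%:R * e) = rho / 2.
    by rewrite /e; field; rewrite (gt_eqF Jp) (gt_eqF B0).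
  have [e' [T [e'0 HT]]] := near_max_long (Jn%:R * h) e0.
  have [t Tt ht] := Mfreq (Num.max T (Jn%:R * h + 1)) e'0.
  move: Tt; rewrite ge_max => /andP[Tt tJ].
  have Hb := HT t Tt ht.
  pose q s := y s - v * s.
  have tth : t <= t + h by rewrite lerDl ltW.
  have cq : continuous q.
    move=> s; apply: cvgB; first exact: (fr_cont fr).
    by apply: cvgM; [exact: cvg_cst|exact: cvg_id].
  have [s] := EVT_max tth (continuous_subspaceT cq).
  rewrite in_itv/= => /andP[ts sth] smax.
  (* going back by h costs at most e, and Jn such steps are needed *)
  have Q j : (j <= Jn)%N -> forall s', t - j%:R * h <= s' -> s' <= t + h -> q s' <= q s +
    j%:R * e.
    elim: j => [_ s' s1 s2|j ih jJ s' s1 s2].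
      by rewrite mul0r addr0; apply: smax; rewrite in_itv/= s2 andbT; lra.
    have [ts'|s't] := leP t s'.
      have : 0 <= j.+1%:R * e by rewrite mulr_ge0// ltW.
      have : q s' <= q s by apply: smax; rewrite in_itv/= s2 ts'.
      lra.
    have hs : M - e <= inc s'.
      have := Hb (t - s'); rewrite (_ : t - (t - s') = s'); last by ring.
      apply; first lra.
      have : j.+1%:R * h <= Jn%:R * h by rewrite ler_pM2r// ler_nat.
      lra.
    have {}ih : q (s' + h) <= q s + j%:R * e.
      by apply: ih; [exact: ltnW| |]; rewrite -natr1 mulrDl mul1r in s1; lra.
    have : q s' <= q (s' + h) + e.
      by rewrite /q /inc in hs *; rewrite mulrDr -ME; lra.
    by rewrite -natr1 mulrDl mul1r; lra.
  have Jh0 : 0 <= Jn%:R * h by rewrite mulr_ge0// ltW.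
  have s0 : 0 <= s by lra.
  rewrite -(fr_eq fr s0).
  have bp := bmeas_profile tk fr s.
  have bR : bmeas (fun r : R => (r <= Jn%:R * h)%R%:R : R) by apply: bmeas_ind;
    exact: measurable_ler_cst.
  apply: (@le_trans _ _ (avg g (fun r => (k (v * r) + (rho / 2 + kappa)) + (- kappa) * (r <=
    Jn%:R * h)%R%:R))).
    apply: (avg_le gf) => //.
      by apply: bmeasD; [exact: bmeasD|exact: bmeasM].
    move=> r r0; have [rJ|Jr] := leP r (Jn%:R * h); last first.
      have : profile k u0 y s r <= kappa.
        by rewrite /profile; case: ifP => _; [exact: (tp_le tk)|exact: (fr_u0_le fr)].
      by have := tp_ge0 tk (v * r); rewrite mulr0; lra.
    rewrite mulr1 /profile ifT; last lra.
    have := Q Jn (leqnn _) (s - r) => hq.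
    have {}hq : q (s - r) <= q s + Jn%:R * e by apply: hq; lra.
    have hX : v * r - Jn%:R * e <= y s - y (s - r) by rewrite /q in hq; lra.
    apply: (le_trans (tp_nincr tk hX)).
    have Je : - (Jn%:R * e) <= 0 by rewrite oppr_le0 mulr_ge0// ltW.
    have := tail_profile_shift_le tk (v * r) Je; rewrite eE; lra.
  rewrite (avgD gf); [|exact: bmeasD|exact: bmeasM].
  rewrite (avgD gf)// (avg_cst gf) (avgZ gf)// (avg_ler gf); last by rewrite mulr_ge0// ltW.
  nra.
rewrite ME ler_pM2r// leNgt; apply/negP => cv.
have [p0 p00 gp0] := kernel_positive_somewhere gf.
(* If c < v, then k (c r) exceeds k (v r) by a definite amount for r in [p, 2 p], where
   both arguments stay in [-d, d]. *)
pose A := 2 * (`|c| + `|v| + 1).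
have A0 : 0 < A by rewrite mulr_gt0// ltr_wpDl// addr_ge0.
pose p := Num.min (p0 / 2) (d / A).
have pp : 0 < p by rewrite lt_min !divr_gt0.
have pp0 : 2 * p <= p0.
  have : p <= p0 / 2 by rewrite ge_min lexx.
  lra.
have pd : A * p <= d by rewrite mulrC -ler_pdivlMr// ge_min lexx orbT.
pose J r := p <= r <= 2 * p.
have bJ : bmeas (fun r => (J r)%:R : R) by apply: bmeas_ind; exact: measurable_itv_cst.
pose gam := m * ((v - c) * p).
have gam0 : 0 < gam by rewrite !mulr_gt0// subr_gt0.
have : avg g (fun r => k (v * r) + gam * (J r)%:R) <= avg g (fun r => k (c * r)).
  apply: (avg_le gf) => //; first by apply: bmeasD => //; apply: bmeasM.
  move=> r r0; have cr : c * r <= v * r by rewrite ler_pM2r// ltW.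
  case hJ : (J r); last by rewrite mulr0 addr0; exact: (tp_nincr tk).
  move: hJ => /andP[J1 J2]; rewrite mulr1.
  have nc := normr_ge0 c; have nv := normr_ge0 v.
  have bound x : `|x| <= `|c| + `|v| -> - d <= x * r /\ x * r <= d.
    move=> hx; have : `|x * r| <= d.
      rewrite normrM (gtr0_norm r0); apply: le_trans pd.
      apply: (@le_trans _ _ ((`|c| + `|v|) * (2 * p))).
        by apply: ler_pM => //; exact: ltW.
      by rewrite /A; nra.
    by rewrite ler_norml => /andP[].
  have [c1 c2] : - d <= c * r /\ c * r <= d by apply: bound; rewrite lerDl.
  have [v1 v2] : - d <= v * r /\ v * r <= d by apply: bound; rewrite lerDr.
  have := tp_strict tk c1 cr v2.
  have : gam <= m * (v * r - c * r).
    by rewrite /gam ler_pM2l// -mulrBl ler_pM2l ?subr_gt0.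
  lra.
rewrite (avgD gf)//; last exact: bmeasM.
rewrite (avgZ gf)// hc => hfin.
have : g p0 * (2 * p - p) <= avg g (fun r => (J r)%:R).
  apply: (avg_itv_ge gf) => //; [lra| |exact: ltW].
  by move=> r ra rb; apply: (mk_nincr gf); lra.
have : 0 < g p0 * (2 * p - p) by rewrite mulr_gt0//; lra.
move=> h1 h2; have : 0 < gam * avg g (fun r => (J r)%:R) by rewrite mulr_gt0// (lt_le_trans h1).
lra.
Qed.

End asymptotics.

(** * The threshold location is a front *)

Lemma memory_kernel_ml {R : realType} (a : R) : 0 < a -> a < 1 ->
  memory_kernel (g_ a) (f_ a).
Proof.
move=> a0 a1; split.
- exact: g_ge0.
- exact: g_nincr.
- exact: g_integrable.
- exact: g_integral0y.
- exact: g_integralty.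
- exact: f_at0.
- move=> t t0; have h := f_bound a0 a1 t0; rewrite ltNge; apply/negP => f1.
  have x0 : 0 < t `^ a / Gamma (a + 1).
    by rewrite divr_gt0 ?powR_gt0//; apply: Gamma_gt0; rewrite addr_gt0.
  have : 1 * (1 + t `^ a / Gamma (a + 1)) <= f_ a t * (1 + t `^ a / Gamma (a + 1)).
    by rewrite ler_wpM2r// addr_ge0// ltW.
  lra.
- exact: f_cvg0.
- exact: f_pinfty.
Qed.

Section tail.
Context {R : realType}.
Local Notation mu := (@lebesgue_measure R).
Variables (K : R -> R) (kappa : R).
Hypothesis K_int : mu.-integrable setT (EFin \o K).
Hypothesis K_bnd : exists M : R, forall x, `|K x| <= M.
Hypothesis K_cont : continuous K.
Hypothesis K_ge0 : forall x, 0 <= K x.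
Hypothesis K0_gt0 : 0 < K 0.
Hypothesis K_even : forall x, K x = K (- x).
Hypothesis kappaE : kappa = \int[mu]_(y in setT) K y.

Let K_integrable_itv (i : interval R) : mu.-integrable [set` i] (EFin \o K).
Proof. by apply: integrableS K_int. Qed.

Lemma tail_integralB x y : x <= y ->
  tail_integral K x - tail_integral K y = \int[mu]_(z in `[x, y[) K z.
Proof.
move=> xy; rewrite /tail_integral.
rewrite (@itv_bndbnd_setU _ _ _ (BLeft y) +oo%O)//.
rewrite Rintegral_setU//; first by rewrite addrK.
- by apply: integrableS K_int => //; exact: measurableU.
- apply/disj_setPLR => z /=; rewrite !in_itv/= andbT => /andP[_ zy].
  by apply/negP; rewrite -ltNge.
Qed.

Lemma tail_integralC x : \int[mu]_(z in `]-oo, x[) K z + tail_integral K x = kappa.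
Proof.
rewrite /tail_integral kappaE -Rintegral_setU//.
- by congr Rintegral; rewrite -itv_bndbnd_setU// set_itvE.
- by apply: integrableS K_int => //; exact: measurableU.
- apply/disj_setPLR => z /=; rewrite !in_itv/= andbT => zy.
  by apply/negP; rewrite -ltNge.
Qed.

(** By evenness of K, reflection turns the integral over [-x, +oo[ into the one over
    ]-oo, x]. *)
Lemma tail_integralN x : tail_integral K (- x) = kappa - tail_integral K x.
Proof.
rewrite -(tail_integralC x) addrK /tail_integral.
rewrite Rintegral_itv_bndo_bndc; last exact: K_integrable_itv.
rewrite [LHS]Rintegral_mkcond [RHS]Rintegral_mkcond.
have i : mu.-integrable setT (EFin \o (K \_ `]-oo, x])).
  by rewrite -restrict_EFin; apply/(integrable_mkcond _ _).1 => //; exact: K_integrable_itv.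
rewrite -[RHS](Rintegral_reflect 0 i); congr Rintegral; apply/funext => z.
rewrite !patchE !mem_setE !in_itv/= andbT sub0r -K_even.
by rewrite lerNl.
Qed.

(** The constants: B bounds K, and m = K 0 / 2 bounds K from below on [-d, d]. *)
Lemma tail_profile_tail_integral : exists B d m, tail_profile (tail_integral K) kappa B d m.
Proof.
have [M HM] := K_bnd.
have [d d0 Hd] : exists2 d, 0 < d & forall x, - d <= x -> x <= d -> K 0 / 2 <= K x.
  have := @K_cont 0 => /cvgrPdist_lt/(_ (K 0 / 2)); rewrite divr_gt0// => /(_ isT)[e /= e0 He].
  exists (e / 2) => [|x x1 x2]; first by rewrite divr_gt0.
  have := He x; rewrite /= sub0r normrN => /(_ _).
  have : `|x| < e by rewrite ltr_norml; apply/andP; split; lra.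
  by move=> h /(_ h); rewrite ltr_norml => /andP[_ h2]; lra.
have mE (x y : R) : x <= y -> fine (mu `[x, y[) = y - x.
  rewrite lebesgue_measure_itv/= lte_fin; rewrite le_eqVlt => /predU1P[->|xy].
    by rewrite ltxx subrr.
  by rewrite xy.
have ic (c x y : R) : mu.-integrable `[x, y[ (EFin \o cst c).
  apply: (@integrableS _ _ _ mu `[x, y]) => //.
    by move=> z /=; rewrite !in_itv/= => /andP[-> /ltW ->].
  apply: continuous_compact_integrable; first exact: segment_compact.
  by apply: continuous_subspaceT => z; exact: cvg_cst.
have nincr x y : x <= y -> tail_integral K y <= tail_integral K x.
  by move=> xy; rewrite -subr_ge0 tail_integralB//; apply: Rintegral_ge0.
exists M, d, (K 0 / 2); split => //.
- by move=> x; apply: Rintegral_ge0.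
- by move=> x; rewrite -(tail_integralC x) lerDr; apply: Rintegral_ge0.
- move=> x y xy; rewrite tail_integralB// -mE// -Rintegral_cst//.
  apply: le_Rintegral => //; first exact: ic.
  by move=> z _; apply: le_trans (HM z); exact: ler_norm.
- by rewrite divr_gt0.
- move=> x y x1 xy y1; rewrite tail_integralB// -mE// -Rintegral_cst//.
  apply: le_Rintegral => //; first exact: ic.
  by move=> z /=; rewrite in_itv/= => /andP[z1 z2]; apply: Hd; lra.
- exact: tail_integralN.
move=> e e0.
pose F n := `]-oo, (n%:R : R)[%classic : set R.
have UF : \bigcup_n F n = setT.
  apply/seteqP; split => // x _; exists (Num.truncn x).+1 => //=.
  by rewrite /F/= in_itv/= truncnS_gt.
have L : (\int[mu]_(x in F i) (K x)%:E)%E @[i --> \oo] --> (\int[mu]_x (K x)%:E)%E.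
  rewrite -UF; apply: ge0_nondecreasing_set_cvg_integral => //.
  - move=> n p np; apply/subsetPset => x; rewrite /F/= !in_itv/= => xn.
    by apply: (lt_le_trans xn); rewrite ler_nat.
  - by move=> i; exact: measurable_itv.
  - move=> i; have h := measurable_int mu K_int; apply: measurable_funS h => //.
  - by move=> i x _; rewrite /= lee_fin.
have {}L : \int[mu]_(x in F i) K x @[i --> \oo] --> kappa.
  rewrite kappaE; apply: (fine_cvg _) => /=.
  by rewrite fineK//; exact: integrable_fin_num.
move/cvgrPdist_lt : L => /(_ e e0)[n _ Hn].
exists n.+1%:R; first by rewrite ltr0n.
have -> : tail_integral K n.+1%:R = kappa - \int[mu]_(z in F n.+1) K z.
  by apply/eqP; rewrite eq_sym subr_eq addrC; apply/eqP/esym; exact: tail_integralC.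
by have /ltW := Hn n.+1 (leqnSn n); apply: le_trans; exact: ler_norm.
Qed.

End tail.

Section data.
Context {R : realType}.
Variables (u0 : R -> R) (kappa : R).
Hypothesis u0_derivable : forall x, derivable u0 x 1.
Hypothesis u0_decr : forall x, (u0^`())%classic x < 0.

Lemma derive1_lt0_nincr x1 x2 : x1 <= x2 -> u0 x2 <= u0 x1.
Proof.
move=> x12; apply: (@ler0_derive1_nincr _ u0 x1 x2) => //.
- by move=> x _; exact: ltW.
- apply: continuous_subspaceT => x.
  by apply: differentiable_continuous; exact/derivable1_diffP.
Qed.

Lemma derive1_lt0_ge x : u0 x @[x --> +oo] --> (0 : R) -> 0 <= u0 x.
Proof.
move=> L; rewrite -(cvg_lim (@Rhausdorff R) L); apply: limr_le.
  by apply/cvg_ex; eexists; exact: L.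
near=> z; apply: derive1_lt0_nincr; near: z; apply: nbhs_pinfty_ge; exact: num_real.
Unshelve. all: by end_near. Qed.

Lemma derive1_lt0_le x : u0 x @[x --> -oo] --> kappa -> u0 x <= kappa.
Proof.
move=> L; rewrite -(cvg_lim (@Rhausdorff R) L); apply: limr_ge.
  by apply/cvg_ex; eexists; exact: L.
near=> z; apply: derive1_lt0_nincr; near: z; apply: nbhs_ninfty_le; exact: num_real.
Unshelve. all: by end_near. Qed.

End data.

Section translate.
Context {R : realType}.
Local Notation mu := (@lebesgue_measure R).
Variables (a : R) (K : R -> R) (kappa uT B d m : R) (u0 xs : R -> R).
Hypothesis a0 : 0 < a.
Hypothesis a1 : a < 1.
Hypothesis tk : tail_profile (tail_integral K) kappa B d m.
Hypothesis u0_0 : u0 0 = uT.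
Hypothesis u0ge0 : forall x, 0 <= u0 x.
Hypothesis u0le : forall x, u0 x <= kappa.
Hypothesis u0nincr : forall x1 x2, x1 <= x2 -> u0 x2 <= u0 x1.
Hypothesis xsP : is_threshold_location a K uT u0 xs.

(** Only the values of xs on [0, +oo[ are known to be continuous: freeze it before 0. *)
Let y t := xs (Num.max 0 t).

Let yE t : 0 <= t -> y t = xs t.
Proof. by move=> t0; rewrite /y max_r. Qed.

Let cont_y : continuous y.
Proof.
have [c _ _] := xsP; move/continuous_within_itvcyP : c => [c c0] t.
have [t0|t0|->] := ltgtP t 0.
- apply: (@near_cst_continuous _ _ (xs 0)).
  near=> z; rewrite /y max_l//.
  have : z < 0 by near: z; exact: lt_nbhsl.
  exact: ltW.
- have ct : {for t, continuous xs} by apply: c; rewrite in_itv/= t0.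
  apply: cvg_trans (_ : xs z @[z --> t] --> _); last by rewrite yE ?ltW//; exact: ct.
  apply: near_eq_cvg; near=> z; rewrite yE// ltW//.
  by near: z; exact: lt_nbhsr.
- apply/cvgrPdist_lt => e e0; rewrite yE//.
  move/cvgrPdist_lt : c0 => /(_ e e0)[q /= q0 H].
  near=> z; have zq : `|0 - z| < q by near: z; exists q.
  have [z0|z0] := ltP 0 z; first by rewrite yE ?ltW//; exact: H.
  by rewrite /y max_l// subrr normr0.
Unshelve. all: by end_near. Qed.

(** Substituting r = t - s turns the integral of the threshold equation into the part r <= t
    of the mean; the part r > t has mass f_ a t. At r = 0 both g0 and g_ a vanish. *)
Lemma front_threshold : front (g_ a) (tail_integral K) kappa uT u0 y.
Proof.
have mk := memory_kernel_ml a0 a1.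
split => //; first by have [_ x0 _] := xsP; rewrite /y max_r.
move=> t t0; have [_ _ /(_ t t0) E] := xsP.
pose k := tail_integral K.
pose phi r := if r <= t then k (y t - y (t - r)) else 0.
have bphi : bmeas phi.
  apply: bmeas_if; [exact: measurable_ler_cst| |exact: bmeas_cst].
  split; last by exists kappa => r; rewrite ger0_norm ?(tp_ge0 tk)// (tp_le tk).
  apply: continuous_measurable_fun => r.
  apply: (@continuous_comp _ _ _ (fun r => y t - y (t - r)) k);
    last exact: (tail_profile_continuous tk).
  apply: cvgB; first exact: cvg_cst.
  apply: (@continuous_comp _ _ _ (fun r => t - r) y); last exact: cont_y.
  by apply: cvgB; [exact: cvg_cst|exact: cvg_id].
have bi : bmeas (fun r : R => (r <= t)%R%:R : R) by apply: bmeas_ind; exact: measurable_ler_cst.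
have bni : bmeas (fun r : R => (- u0 (y t)) * (r <= t)%R%:R : R) by apply: bmeasM => //;
  exact: bmeas_cst.
have -> : profile k u0 y t = (fun r => phi r + (u0 (y t) + (- u0 (y t)) * (r <= t)%R%:R)).
  apply/funext => r; rewrite /profile /phi; case: (r <= t) => /=; ring.
rewrite (avgD mk)//; last by apply: bmeasD => //; exact: bmeas_cst.
rewrite (avgD mk)//; last exact: bmeas_cst.
rewrite (avg_cst mk) (avgZ mk)// (avg_ler mk)//.
rewrite -[RHS]E addrC yE//; congr (_ + _); first by ring.
rewrite /avg -(Rintegral_reflect t (avg_integrable mk bphi)) [RHS]Rintegral_mkcond.
congr Rintegral; apply/funext => s; rewrite patchE mem_setE in_itv/=.
rewrite /phi /g0 subr_gt0 lerBlDr lerDl subKr.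
have [s0|s0] := leP 0 s => /=; last by rewrite mulr0.
have [st|st|->] := ltgtP s t.
- by rewrite (yE s0) (yE t0).
- by rewrite mul0r.
- by rewrite mul0r subrr /g_ powR0 ?mul0r// lt_eqF// subr_lt0.
Qed.

Lemma wave_speed_avg c : is_wave_speed a K uT c ->
  avg (g_ a) (fun r => tail_integral K (c * r)) = uT.
Proof.
move=> ->; rewrite /avg [RHS]Rintegral_mkcond; congr Rintegral; apply/funext => r.
rewrite patchE mem_setE in_itv/= andbT /g0; case: ifP => //.
by rewrite mul0r.
Qed.

End translate.

(** * Convergence of the increments *)

(** Cut h into equal steps on which the function varies by at most 1. *)
Lemma late_ucont_bounded_increment {R : realType} (y : R -> R) (h : R) : late_ucont y -> 0 < h ->
  exists C, forall t, 1 <= t -> `|y (t + h) - y t| <= C.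
Proof.
move=> uc h0; have [tau tau0 H] := uc 1 ltr01.
pose N := (Num.truncn (h / tau)).+1.
have N0 : 0 < N%:R :> R by rewrite ltr0n.
have hN : h / N%:R <= tau.
  by rewrite ler_pdivrMr// mulrC -ler_pdivrMr// ltW// truncnS_gt.
have hN0 : 0 <= h / N%:R by rewrite divr_ge0// ltW.
exists N%:R => t t1.
have P n : `|y (t + n%:R * (h / N%:R)) - y t| <= n%:R.
  elim: n => [|n ih]; first by rewrite mul0r addr0 subrr normr0.
  rewrite -natr1 mulrDl mul1r addrA.
  have := H (t + n%:R * (h / N%:R)) (h / N%:R) _ hN0 hN.
  have -> : y (t + n%:R * (h / N%:R) + h / N%:R) - y t =
    (y (t + n%:R * (h / N%:R)) - y t) + (y (t + n%:R * (h / N%:R) + h / N%:R) - y (t + n%:R *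
      (h / N%:R))) by ring.
  move=> h1; apply: (le_trans (ler_normD _ _)); apply: lerD => //.
  by apply: h1; rewrite (le_trans t1)// lerDl mulr_ge0.
by have := P N; rewrite mulrCA divff ?mulr1// gt_eqF.
Qed.

Section speed.
Context {R : realType}.
Variables (g f : R -> R) (k : R -> R) (kappa B d m : R).
Hypothesis gf : memory_kernel g f.
Hypothesis tk : tail_profile k kappa B d m.

Lemma increment_upper (uT : R) (u0 y : R -> R) (c h e : R) :
  front g k kappa uT u0 y -> late_ucont y -> avg g (fun r => k (c * r)) = uT ->
  0 < h -> 0 < e -> exists T, forall t, T <= t -> y (t + h) - y t <= c * h + e.
Proof.
move=> fr uc hc h0 e0.
have [C HC] := late_ucont_bounded_increment uc h0.
have [M [Mub Mfreq]] := limsup_exists HC.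
have := limsup_increment_le gf tk fr uc h0 Mub Mfreq hc => Mc.
have [T HT] := Mub e e0; exists T => t /HT.
by move/le_trans; apply; rewrite lerD2r.
Qed.

(** The lower bound is the upper bound for the reflected front, whose speed is -c. *)
Lemma increment_limit (uT : R) (u0 y : R -> R) (c h e : R) :
  front g k kappa uT u0 y -> late_ucont y -> avg g (fun r => k (c * r)) = uT ->
  0 < h -> 0 < e -> exists T, forall t, T <= t -> `|y (t + h) - y t - c * h| <= e.
Proof.
move=> fr uc hc h0 e0.
have [T1 H1] := increment_upper fr uc hc h0 e0.
have fr' := front_reflect gf tk fr.
have uc' : late_ucont (fun t => - y t).
  move=> de /uc[tau tau0 H]; exists tau => // s r s1 r0 rt.
  by rewrite -opprD normrN; exact: H.
have hc' : avg g (fun r => k (- c * r)) = kappa - uT.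
  have bl := bmeas_linear tk c.
  transitivity (avg g (fun r => kappa + (-1) * k (c * r))).
    congr avg; apply/funext => r; rewrite mulN1r -(tp_sym tk); congr k.
    by rewrite mulNr.
  rewrite (avgD gf); [|exact: bmeas_cst|by apply: bmeasM => //; exact: bmeas_cst].
  by rewrite (avg_cst gf) (avgZ gf)// hc mulN1r.
have [T2 H2] := increment_upper fr' uc' hc' h0 e0.
exists (Num.max T1 T2) => t; rewrite ge_max => /andP[/H1 h1 /H2 h2].
by rewrite ler_norml; apply/andP; split; lra.
Qed.

(** Exactly one of the front and its reflection has its level below k 0 = kappa / 2. *)
Lemma front_late_ucont (uT : R) (u0 y : R -> R) :
  front g k kappa uT u0 y -> 0 < uT -> uT < kappa -> kappa <> 2 * uT -> late_ucont y.
Proof.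
have k0 : k 0 = kappa / 2 by have := tp_sym tk 0; rewrite oppr0 => h; lra.
have P (uT' : R) (u0' y' : R -> R) :
    front g k kappa uT' u0' y' -> 0 < uT' -> uT' < k 0 -> late_ucont y'.
  move=> fr u1 u2 de de0; have [tau tau0 H] := front_small_increments gf tk fr u2 u1 de0.
  exists tau => // s r s1 r0 rt; rewrite ger0_norm; first exact: H.
  by rewrite subr_ge0; apply: (front_nondecreasing gf tk fr u2); lra.
move=> fr u1 u2 ne; have [l|l] := ltP uT (k 0); first exact: P fr u1 l.
have fr' := front_reflect gf tk fr.
have uk : kappa / 2 < uT by rewrite lt_neqAle -k0 l andbT; apply/eqP => E; apply: ne; lra.
have uc : late_ucont (fun t => - y t) by apply: P fr' _ _; rewrite ?k0; lra.
move=> de /uc[tau tau0 H]; exists tau => // s r s1 r0 rt.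
by rewrite -normrN opprD; exact: H.
Qed.

(** Equicontinuity reduces the segment [0, L] to a finite grid. *)
Lemma increment_uniform (uT : R) (u0 y : R -> R) (c L e : R) :
  front g k kappa uT u0 y -> late_ucont y -> avg g (fun r => k (c * r)) = uT ->
  0 < e -> exists T, forall t, T <= t -> forall r, 0 <= r -> r <= L ->
    `|y t - y (t - r) - c * r| <= e.
Proof.
move=> fr uc hc e0; have e3 : 0 < e / 3 by rewrite divr_gt0.
have [tau1 tau10 H] := uc _ e3.
have c1 : 0 < `|c| + 1 by rewrite ltr_wpDl.
pose tau := Num.min tau1 (e / 3 / (`|c| + 1)).
have tau0 : 0 < tau by rewrite lt_min tau10 divr_gt0.
have t1 : tau <= tau1 by rewrite ge_min lexx.
have t2 : `|c| * tau <= e / 3.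
  have : tau <= e / 3 / (`|c| + 1) by rewrite ge_min lexx orbT.
  rewrite ler_pdivlMr// => h; apply: le_trans h; rewrite mulrC ler_pM2l// lerDl//.
have grid n : exists T, forall t, T <= t -> forall i, (i <= n)%N ->
    `|y t - y (t - i%:R * tau) - c * (i%:R * tau)| <= e / 3.
  elim: n => [|n [T HT]].
    exists 0 => t _ i; rewrite leqn0 => /eqP ->.
    by rewrite mul0r subr0 subrr sub0r mulr0 oppr0 normr0 ltW.
  have ht : 0 < n.+1%:R * tau by rewrite mulr_gt0.
  have [T' HT'] := increment_limit fr uc hc ht e3.
  exists (Num.max T (T' + n.+1%:R * tau)) => t; rewrite ge_max => /andP[tT tT'] i.
  rewrite leq_eqVlt => /predU1P[->|]; last by rewrite ltnS; exact: HT.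
  by have := HT' (t - n.+1%:R * tau); rewrite subrK; apply; lra.
pose N := Num.truncn (L / tau).
have [T HT] := grid N.
exists (Num.max T (L + 1)) => t; rewrite ge_max => /andP[tT tL] r r0 rL.
pose i := Num.truncn (r / tau).
have /andP[i1 i2] : i%:R <= r / tau < i.+1%:R by apply: truncn_itv; rewrite divr_ge0// ltW.
rewrite ler_pdivlMr// in i1; rewrite ltr_pdivrMr// -natr1 mulrDl mul1r in i2.
have iN : (i <= N)%N by apply: le_truncn; rewrite ler_pM2r ?invr_gt0.
have h1 := HT t tT i iN.
have {}h2 : `|y (t - i%:R * tau) - y (t - r)| <= e / 3.
  have := H (t - r) (r - i%:R * tau);
    rewrite (_ : t - r + (r - i%:R * tau) = t - i%:R * tau); last by ring.
  by apply; lra.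
have h3 : `|c * (r - i%:R * tau)| <= e / 3.
  rewrite normrM; apply: le_trans t2; apply: ler_wpM2l => //.
  by rewrite ger0_norm; lra.
have -> : y t - y (t - r) - c * r = (y t - y (t - i%:R * tau) - c * (i%:R * tau)) +
   (y (t - i%:R * tau) - y (t - r)) - c * (r - i%:R * tau) by ring.
apply: (le_trans (ler_normB _ _)); rewrite [leRHS](_ : _ = e / 3 + e / 3 + e / 3); last by field.
by apply: lerD => //; apply: (le_trans (ler_normD _ _)); exact: lerD.
Qed.

End speed.

Theorem proposition3p13 (R : realType) (a : R) (K : R -> R) (kappa uT : R)
    (u0 xs : R -> R) (cs : R)
    (a_gt0 : 0 < a) (a_lt1 : a < 1)
    (K_int : (@lebesgue_measure R).-integrable setT (EFin \o K))
    (K_bnd : exists M : R, forall x, `|K x| <= M)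
    (K_cont : continuous K)
    (K_ge0 : forall x, 0 <= K x)
    (K0_gt0 : 0 < K 0)
    (K_even : forall x, K x = K (- x))
    (kappaE : kappa = \int[@lebesgue_measure R]_(y in setT) K y)
    (uT_gt0 : 0 < uT) (uT_lt : uT < kappa)
    (u0_derivable : forall x, derivable u0 x 1)
    (u0_C1 : continuous (u0^`())%classic)
    (u0_decr : forall x, (u0^`())%classic x < 0)
    (u0_0 : u0 0 = uT)
    (u0_ninfty : u0 x @[x --> -oo] --> kappa)
    (u0_pinfty : u0 x @[x --> +oo] --> (0 : R))
    (xs_threshold : is_threshold_location a K uT u0 xs)
    (cs_speed : is_wave_speed a K uT cs)
    (kappa_neq : kappa <> 2 * uT) :
  forall L : R, 0 < L ->
    sup [set `|xs t - xs (t - r) - cs * r| | r in `[0, L]] @[t --> +oo]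
      --> (0 : R).
Proof.
move=> L L0.
have [B [d [m tk]]] := tail_profile_tail_integral K_int K_bnd K_cont K_ge0 K0_gt0 K_even kappaE.
have mk := memory_kernel_ml a_gt0 a_lt1.
have u0nincr := derive1_lt0_nincr u0_derivable u0_decr.
have u0ge0 x := derive1_lt0_ge u0_derivable u0_decr x u0_pinfty.
have u0le x := derive1_lt0_le u0_derivable u0_decr x u0_ninfty.
have fr := front_threshold a_gt0 a_lt1 tk u0_0 u0ge0 u0le u0nincr xs_threshold.
have uc := front_late_ucont mk tk fr uT_gt0 uT_lt kappa_neq.
have hc := wave_speed_avg cs_speed.
apply/cvgrPdist_le => e e0.
have [T HT] := increment_uniform mk tk L fr uc hc e0.
near=> t.
have tT : T <= t by near: t; apply: nbhs_pinfty_ge; exact: num_real.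
have tL : L <= t by near: t; apply: nbhs_pinfty_ge; exact: num_real.
set E := (X in sup X).
have bE x : E x -> 0 <= x <= e.
  move=> [r /=]; rewrite in_itv/= => /andP[r0 rL] <-; rewrite normr_ge0/=.
  have t0 : 0 <= t by rewrite (le_trans (ltW L0)).
  have tr0 : 0 <= t - r by rewrite subr_ge0 (le_trans rL).
  by have := HT t tT r r0 rL; rewrite (max_r t0) (max_r tr0).
have E0 : E !=set0.
  by exists `|xs t - xs (t - 0) - cs * 0|; exists 0 => //=; rewrite in_itv/= lexx ltW.
have se : sup E <= e by apply: ge_sup => // x /bE/andP[].
have s0 : 0 <= sup E.
  have [x Ex] := E0; have /andP[x0 _] := bE x Ex.
  apply: (le_trans x0); apply: ub_le_sup => //.
  by exists e => z /bE/andP[].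
by rewrite sub0r normrN ger0_norm.
Unshelve. all: by end_near. Qed.
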